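(* Let $G$ be a group. Then: (1) $\gamma_*^{\mathbb Q}(G)=\sqrt{\gamma_*(G)}$ is an $N$-series. Moreover, if a group $K$ acts on a group $H$ by automorphisms, then: (2) $\gamma_*^{\mathbb Q}(H\rtimes K)=\sqrt{\gamma_*^K(H)}\rtimes\gamma_*^{\mathbb Q}(K)$, i.e. $\gamma_i^{\mathbb Q}(H\rtimes K)=\sqrt{\gamma_i^K(H)}\rtimes\gamma_i^{\mathbb Q}(K)$ for all $i\ge1$; (3) if $K$ acts trivially on $H^{\mathrm{abf}}$, then $\sqrt{\gamma_*^K(H)}=\gamma_*^{\mathbb Q}(H)$. In particular, if $K$ acts trivially on $H^{\mathrm{abf}}$, then there is a canonical isomorphism of graded Lie rings $\mathrm{gr}_*^{\mathbb Q}(H\rtimes K)\cong\mathrm{gr}_*^{\mathbb Q}(H)\rtimes\mathrm{gr}_*^{\mathbb Q}(K)$.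
   Context: Commutators are $[a,b]=aba^{-1}b^{-1}$; $[A,B]$ is the subgroup generated by the $[a,b]$, $a\in A$, $b\in B$. A filtration $G_*$ on a group $G$ is a sequence of subgroups $G=G_1\supseteq G_2\supseteq\cdots$. It is central if $[G,G_i]\subseteq G_{i+1}$ for all $i$; an $N$-series if $[G_i,G_j]\subseteq G_{i+j}$ for all $i,j$; a central filtration is torsion-free if each $G_i/G_{i+1}$ is torsion-free. For an $N$-series, $\mathrm{gr}(G_* )=\bigoplus_{i\ge1}G_i/G_{i+1}$ is a graded Lie ring with bracket induced by commutators. $\gamma_*(G)$ is the lower central series. The rational lower central series $\gamma_*^{\mathbb Q}(G)$ is the smallest torsion-free central filtration on $G$ (for termwise inclusion), and $\mathrm{gr}_*^{\mathbb Q}(G)=\mathrm{gr}(\gamma_*^{\mathbb Q}(G))$. For a subset $S$ of a group $G$, $\sqrt S=\{g\in G\mid g^m\in S\text{ for some integer }m\ge1\}$ is its isolator in $G$, and $\sqrt{G_*}$ is the sequence $(\sqrt{G_i})_{i\ge1}$ (isolators taken in $G=G_1$). $H^{\mathrm{abf}}$ is the quotient of the abelianization $H^{\mathrm{ab}}$ by its torsion subgroup. If $K$ acts on $H$, then $\gamma_1^K(H)=H$ and $\gamma_{n+1}^K(H)=[H\rtimes K,\gamma_n^K(H)]$ (in $H\rtimes K$); isolators of the $\gamma_i^K(H)$ are taken in $H$. If $K_*$ and $H_*$ are $N$-series and $[K_j,H_i]\subseteq H_{i+j}$ in $H\rtimes K$ for all $i,j\geq 1$, then $\mathrm{gr}(K_*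 )$ acts on $\mathrm{gr}(H_* )$ by derivations via $\bar k\cdot\bar h=\overline{(k\cdot h)h^{-1}}$, and $\mathrm{gr}(H_* )\rtimes\mathrm{gr}(K_* )$ is the direct sum with bracket $[(h,k),(h',k')]=([h,h']+k\cdot h'-k'\cdot h,[k,k'])$; this applies to $H_*=\gamma_*^{\mathbb Q}(H)$ and $K_*=\gamma_*^{\mathbb Q}(K)$ in the last statement. *)

(* Defs.v *)
From HB Require Import structures.
From mathcomp Require Import all_boot all_algebra.
From mathcomp Require Import boolp classical_sets.

Set Implicit Arguments.
Unset Strict Implicit.
Unset Printing Implicit Defensive.

Import GRing.Theory.

Local Open Scope classical_set_scope.
Local Open Scope group_scope.

(* The convention for commutators is [a, b] = a b a^-1 b^-1, whereas
   MathComp's [~ a, b] is a^-1 b^-1 a b. *)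
Definition comm (G : groupType) (a b : G) : G := a * b * a^-1 * b^-1.

Definition subgroup (G : groupType) (A : set G) : Prop :=
  [/\ A 1, forall x y, A x -> A y -> A (x * y) & forall x, A x -> A x^-1].

Definition comm_sub (G : groupType) (A B : set G) : set G :=
  smallest (@subgroup G) [set comm a b | a in A & b in B].

Definition isolator (G : groupType) (S : set G) : set G :=
  [set g | exists2 m : nat, (0 < m)%N & S (g ^+ m)].

Section SubgroupTheory.
Variable G : groupType.
Implicit Types (A B C : set G) (g h x y : G).

Lemma subgroup_bigcap (I : Type) (D : set I) (F : I -> set G) :
  (forall i, D i -> subgroup (F i)) -> subgroup (\bigcap_(i in D) F i).
Proof.
move=> sF; split=> [i Di|x y Fx Fy i Di|x Fx i Di]; have [F1 FM FV] := sF i Di.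
- exact: F1.
- by apply: FM; [apply: Fx|apply: Fy].
- by apply: FV; apply: Fx.
Qed.

Lemma subgroup_comm_sub A B : subgroup (comm_sub A B).
Proof. by apply: subgroup_bigcap => C []. Qed.

Lemma mem_comm_sub A B a b : A a -> B b -> comm_sub A B (comm a b).
Proof. by move=> Aa Bb; apply: sub_gen_smallest; exists a => //; exists b. Qed.

Lemma comm_sub_subP A B C : subgroup C ->
  comm_sub A B `<=` C <-> (forall a b, A a -> B b -> C (comm a b)).
Proof.
move=> sC; split=> [sub a b Aa Bb|AB]; first by apply: sub; apply: mem_comm_sub.
by apply: smallest_sub => // _ [a Aa [b Bb <-]]; apply: AB.
Qed.

Lemma commE_conj g h : g * h * g^-1 = comm g h * h.
Proof. by rewrite /comm !gnorm. Qed.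

Lemma commMl a a' b :
  comm (a * a') b = (a * comm a' b * a^-1) * comm a b :> G.
Proof. by rewrite /comm !gnorm. Qed.

Lemma commMr a b b' :
  comm a (b * b') = comm a b * (b * comm a b' * b^-1) :> G.
Proof. by rewrite /comm !gnorm. Qed.

Lemma commV a b : comm a b = (comm b a)^-1 :> G.
Proof. by rewrite /comm !gnorm. Qed.

Lemma Hall_Witt a b c : comm (comm a b) (b * c * b^-1) *
  comm (comm b c) (c * a * c^-1) * comm (comm c a) (a * b * a^-1) = 1 :> G.
Proof. by rewrite /comm !gnorm. Qed.

End SubgroupTheory.

(* A quotient A / B, for subgroups B <= A of G with B normal in A, consists of
   the left cosets a B with a in A. *)
Record section (G : groupType) := Section {
  top : set G;
  bot : set G;
  top_grp : subgroup top;
  bot_grp : subgroup bot;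
  bot_top : bot `<=` top;
  bot_norm : forall a b, top a -> bot b -> bot (a * b * a^-1) }.

Definition left_coset (G : groupType) (g : G) (B : set G) : set G :=
  [set x | B (g^-1 * x)].

Record quo (G : groupType) (s : section G) := Quo {
  cosetq : set G;
  cosetqP : exists2 g, top s g & cosetq = left_coset g (bot s) }.

HB.instance Definition _ (G : groupType) (s : section G) :=
  gen_eqMixin (quo s).
HB.instance Definition _ (G : groupType) (s : section G) :=
  gen_choiceMixin (quo s).

Section Quotient.
Variables (G : groupType) (s : section G).
Implicit Types (g h : G) (x y z : quo s).

Definition reprq x : G := sval (cid2 (cosetqP x)).

Definition cls_in g (sg : top s g) : quo s :=
  @Quo G s (left_coset g (bot s)) (ex_intro2 _ _ g sg erefl).

Definition one_in : top s 1 := let: And3 p _ _ := top_grp s in p.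

(* The class of g, with the junk value 1 when g is not in the numerator. *)
Definition cls g : quo s :=
  if pselect (top s g) is left sg then cls_in sg else cls_in one_in.

Lemma quo_inj x y : cosetq x = cosetq y -> x = y.
Proof.
case: x y => [A pA] [B pB] /= AB; rewrite AB in pA *.
by rewrite (Prop_irrelevance pA pB).
Qed.

Lemma topM g h : top s g -> top s h -> top s (g * h).
Proof. by case: (top_grp s) => _ + _; apply. Qed.

Lemma topV g : top s g -> top s g^-1.
Proof. by case: (top_grp s) => _ _; apply. Qed.

Lemma bot1 : bot s 1. Proof. by case: (bot_grp s). Qed.

Lemma botM g h : bot s g -> bot s h -> bot s (g * h).
Proof. by case: (bot_grp s) => _ + _; apply. Qed.

Lemma botV g : bot s g -> bot s g^-1.
Proof. by case: (bot_grp s) => _ _; apply. Qed.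

Lemma cosetq_cls g : top s g -> cosetq (cls g) = left_coset g (bot s).
Proof. by rewrite /cls; case: pselect. Qed.

Lemma clsP g h : top s g -> top s h -> cls g = cls h <-> bot s (g^-1 * h).
Proof.
move=> sg sh; split=> [gh|b].
  have : left_coset g (bot s) h by rewrite -cosetq_cls// gh cosetq_cls// /left_coset/= mulVg; apply: bot1.
  by [].
apply: quo_inj; rewrite !cosetq_cls//; apply/seteqP; split=> x; rewrite /left_coset /= => xb.
  have -> : h^-1 * x = (g^-1 * h)^-1 * (g^-1 * x) by rewrite !gnorm.
  by apply: botM => //; apply: botV.
have -> : g^-1 * x = (g^-1 * h) * (h^-1 * x) by rewrite !gnorm.
exact: botM.
Qed.

Lemma reprq_top x : top s (reprq x).
Proof. by rewrite /reprq; case: cid2. Qed.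

Lemma reprqK x : cls (reprq x) = x.
Proof.
by apply: quo_inj; rewrite cosetq_cls; [rewrite /reprq; case: cid2|apply: reprq_top].
Qed.

Lemma cls_repr g : top s g -> exists2 b, bot s b & reprq (cls g) = g * b.
Proof.
move=> sg; exists (g^-1 * reprq (cls g)); last by rewrite !gnorm.
by apply/clsP => //; [apply: reprq_top|rewrite reprqK].
Qed.

Lemma cls_eq1 g : top s g -> cls g = cls 1 <-> bot s g.
Proof.
move=> sg; rewrite (clsP sg one_in) mulg1; split=> [/botV|/botV//].
by rewrite invgK.
Qed.

Lemma cls_out g : ~ top s g -> cls g = cls 1.
Proof.
rewrite /cls; case: pselect => // _ _; case: pselect => [p|/(_ one_in)//].
exact: quo_inj.
Qed.

Lemma quo_ind (P : quo s -> Prop) : (forall g, top s g -> P (cls g)) ->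
  forall x, P x.
Proof. by move=> Pc x; rewrite -(reprqK x); apply/Pc/reprq_top. Qed.

Definition mulq x y : quo s := cls (reprq x * reprq y).
Definition invq x : quo s := cls (reprq x)^-1.

Lemma mulq_cls g h : top s g -> top s h -> mulq (cls g) (cls h) = cls (g * h).
Proof.
move=> sg sh; rewrite /mulq; have [b bb ->] := cls_repr sg.
have [c bc ->] := cls_repr sh.
have tb := bot_top bb; have tc := bot_top bc.
apply/clsP; [by do !apply: topM|exact: topM|].
have -> : (g * b * (h * c))^-1 * (g * h) = c^-1 * (h^-1 * b^-1 * h^-1^-1).
  by rewrite !gnorm.
by apply: botM; [apply: botV|apply: bot_norm; [apply: topV|apply: botV]].
Qed.

Lemma invq_cls g : top s g -> invq (cls g) = cls g^-1.
Proof.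
move=> sg; rewrite /invq; have [b bb ->] := cls_repr sg.
have tb := bot_top bb.
apply/clsP; [by apply/topV/topM|exact: topV|].
have -> : (g * b)^-1^-1 * g^-1 = g * b * g^-1 by rewrite !gnorm.
exact: bot_norm.
Qed.

Lemma mulqA : associative mulq.
Proof.
elim/quo_ind=> g sg; elim/quo_ind=> h sh; elim/quo_ind=> k sk.
by rewrite !mulq_cls ?mulgA//; apply: topM.
Qed.

Lemma mul1q : left_id (cls 1) mulq.
Proof. by elim/quo_ind=> g sg; rewrite mulq_cls ?mul1g//; apply: one_in. Qed.

Lemma mulq1 : right_id (cls 1) mulq.
Proof. by elim/quo_ind=> g sg; rewrite mulq_cls ?mulg1//; apply: one_in. Qed.

Lemma mulVq : left_inverse (cls 1) invq mulq.
Proof. by elim/quo_ind=> g sg; rewrite invq_cls// mulq_cls ?mulVg//; apply: topV. Qed.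

Lemma mulqV : right_inverse (cls 1) invq mulq.
Proof. by elim/quo_ind=> g sg; rewrite invq_cls// mulq_cls ?mulgV//; apply: topV. Qed.

End Quotient.

HB.instance Definition _ (G : groupType) (s : section G) :=
  isGroup.Build (quo s) (@mulqA G s) (@mul1q G s) (@mulq1 G s)
    (@mulVq G s) (@mulqV G s).

Section QuotientTheory.
Variables (G : groupType) (s : section G).
Implicit Types (g h : G).

Lemma clsM g h : top s g -> top s h -> cls s (g * h) = cls s g * cls s h.
Proof. by move=> sg sh; rewrite -mulq_cls. Qed.

Lemma clsV g : top s g -> cls s g^-1 = (cls s g)^-1.
Proof. by move=> sg; rewrite -invq_cls. Qed.

Lemma cls1P g : top s g -> cls s g = 1 <-> bot s g.
Proof. exact: cls_eq1. Qed.

Lemma topX g m : top s g -> top s (g ^+ m).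
Proof.
move=> sg; elim: m => [|m IH]; first exact: one_in.
by rewrite expgS; apply: topM.
Qed.

Lemma clsX g m : top s g -> cls s (g ^+ m) = cls s g ^+ m.
Proof.
move=> sg; elim: m => [|m IH]; first by [].
by rewrite !expgS clsM ?IH//; apply: topX.
Qed.

Lemma quo_commute : (forall a b, top s a -> top s b -> bot s (comm a b)) ->
  forall x y : quo s, x * y = y * x.
Proof.
move=> ab; elim/quo_ind=> g sg; elim/quo_ind=> h sh; rewrite -!clsM//.
apply/clsP; [exact: topM|exact: topM|].
have -> : (g * h)^-1 * (h * g) = comm h^-1 g^-1 by rewrite /comm !gnorm.
by apply: ab; apply: topV.
Qed.

End QuotientTheory.

Definition torsion (Q : groupType) : set Q :=
  [set x | exists2 m : nat, (0 < m)%N & x ^+ m = 1].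

Definition torsion_free (Q : groupType) : Prop := @torsion Q `<=` [set 1].

(* Sequences of subgroups G_1, G_2, ... are functions on nat whose value at 0
   is never used. *)
Definition filtration (G : groupType) (F : nat -> set G) : Prop :=
  [/\ F 1%N = setT, forall i, (0 < i)%N -> subgroup (F i)
    & forall i, (0 < i)%N -> F i.+1 `<=` F i].

Definition central (G : groupType) (F : nat -> set G) : Prop :=
  filtration F /\
  forall i, (0 < i)%N -> comm_sub setT (F i) `<=` F i.+1.

Definition nseries (G : groupType) (F : nat -> set G) : Prop :=
  filtration F /\
  forall i j, (0 < i)%N -> (0 < j)%N -> comm_sub (F i) (F j) `<=` F (i + j)%N.

Lemma nseries_central (G : groupType) (F : nat -> set G) :
  nseries F -> central F.
Proof.
move=> [fF cF]; split=> // i i0; case: (fF) => <- _ _.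
by rewrite -(add1n i); apply: cF.
Qed.

Section CentralSection.
Variables (G : groupType) (F : nat -> set G) (cF : central F).

Lemma central_grp n : subgroup (F n.+1).
Proof. by case: cF => -[_ + _] _; apply. Qed.

Lemma central_sub n : F n.+2 `<=` F n.+1.
Proof. by case: cF => -[_ _ +] _; apply. Qed.

Lemma central_comm n a b : F n.+1 b -> F n.+2 (comm a b).
Proof.
by move=> Fb; case: cF => _ /(_ n.+1 isT); apply; apply: mem_comm_sub.
Qed.

Lemma central_norm n a b : F n.+1 b -> F n.+1 (a * b * a^-1).
Proof.
move=> Fb; rewrite commE_conj; case: (central_grp n) => _ M _; apply: M => //.
exact/central_sub/central_comm.
Qed.

(* G_{n+1} / G_{n+2} *)
Definition csec (n : nat) : section G :=
  Section (central_grp n) (central_grp n.+1) (@central_sub n)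
    (fun a b _ => @central_norm n.+1 a b).

End CentralSection.

Definition tf_central (G : groupType) (F : nat -> set G) : Prop :=
  exists cF : central F, forall n, torsion_free (quo (csec cF n)).

Fixpoint lcs (G : groupType) (n : nat) : set G :=
  if n is m.+1 then (if m is 0 then setT else comm_sub setT (lcs m))
  else setT.
Arguments lcs G n : clear implicits.

Definition ratlcs (G : groupType) (i : nat) : set G :=
  \bigcap_(F in [set F | @tf_central G F]) F i.
Arguments ratlcs G i : clear implicits.

Lemma torsion_freeE (G : groupType) (s : section G) : torsion_free (quo s) <->
  (forall g m, (0 < m)%N -> top s g -> bot s (g ^+ m) -> bot s g).
Proof.
split=> [tf g m m0 sg|tf].
  move=> /(cls1P (topX m sg)); rewrite clsX// => gm1.
  by apply/(cls1P sg)/tf; exists m.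
move=> x [m m0]; elim/quo_ind: x => g sg; rewrite -clsX// => /(cls1P (topX m sg)).
by move=> /(tf _ _ m0 sg) /(cls1P sg).
Qed.

(* ratlcs is indeed the smallest torsion-free central filtration. *)
Lemma ratlcs_tf_central (G : groupType) : tf_central (ratlcs G).
Proof.
have cG : central (ratlcs G).
  split; first split.
  - by apply/seteqP; split=> // x _ F [[[F1 _ _] _] _]; rewrite F1.
  - by move=> i i0; apply: subgroup_bigcap => F [[[_ + _] _] _]; apply.
  - by move=> i i0 x xi F FF; have [[[_ _ +] _] _] := FF; apply=> //; apply: xi.
  move=> [//|i] _; apply/comm_sub_subP => [|a b _ bi F FF].
    by apply: subgroup_bigcap => F [[[_ + _] _] _]; apply.
  by have [cF _] := FF; apply: (central_comm cF); apply: bi.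
exists cG => n; apply/torsion_freeE => /= g m m0 gn gm F FF.
have [cF /(_ n) /torsion_freeE tf] := FF.
by apply: (tf g m) => //=; [apply: gn|apply: gm].
Qed.

Lemma ratlcs_min (G : groupType) (F : nat -> set G) (i : nat) :
  tf_central F -> ratlcs G i `<=` F i.
Proof. by move=> FF x; apply. Qed.

Section Abelianization.
Variable G : groupType.

Lemma norm_derived (a b : G) :
  [set: G] a -> comm_sub setT setT b -> comm_sub setT setT (a * b * a^-1).
Proof.
move=> _ Db; rewrite commE_conj.
case: (subgroup_comm_sub [set: G] setT) => _ M _; apply: M => //.
exact: mem_comm_sub.
Qed.

Definition ab_sec : section G := Section
  (And3 (I : [set: G] 1) (fun _ _ _ _ => I) (fun _ _ => I))
  (subgroup_comm_sub setT setT) (fun _ _ => I) norm_derived.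

Definition ab : groupType := quo ab_sec.

Lemma abC (x y : ab) : x * y = y * x.
Proof. by apply: quo_commute => a b _ _; apply: mem_comm_sub. Qed.

Lemma torsion_ab_grp : subgroup (@torsion ab).
Proof.
split=> [|x y [m m0 xm] [n n0 yn]|x [m m0 xm]].
- by exists 1%N; rewrite ?expg1.
- exists (m * n)%N; first by rewrite muln_gt0 m0.
  rewrite expgMn; last exact: abC.
  by rewrite expgnA xm mulnC expgnA yn !expg1n mulg1.
- by exists m => //; rewrite expVgn xm invg1.
Qed.

Lemma norm_torsion (x y : ab) :
  [set: ab] x -> torsion y -> torsion (x * y * x^-1).
Proof. by move=> _; rewrite abC mulKg. Qed.

Definition abf_sec : section ab := Section
  (And3 (I : [set: ab] 1) (fun _ _ _ _ => I) (fun _ _ => I))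
  torsion_ab_grp (fun _ _ => I) norm_torsion.

Definition abf : groupType := quo abf_sec.

Definition abf_proj (g : G) : abf := cls abf_sec (cls ab_sec g).

End Abelianization.

Record gact (K H : groupType) := GAct {
  gactf :> K -> H -> H;
  gact1 : forall h, gactf 1 h = h;
  gactM : forall k l h, gactf (k * l) h = gactf k (gactf l h);
  gact_mul : forall k h h', gactf k (h * h') = gactf k h * gactf k h' }.

Section ActionTheory.
Variables (K H : groupType) (a : gact K H).

Lemma gact_one k : a k 1 = 1.
Proof. by apply: (@mulgI _ (a k 1)); rewrite -gact_mul !mulg1. Qed.

Lemma gactV k h : a k h^-1 = (a k h)^-1.
Proof. by apply: (@mulgI _ (a k h)); rewrite -gact_mul !mulgV gact_one. Qed.

Lemma gact_comm k h h' : a k (comm h h') = comm (a k h) (a k h').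
Proof. by rewrite /comm !gact_mul !gactV. Qed.

Lemma gactX k h m : a k (h ^+ m) = (a k h) ^+ m.
Proof.
by elim: m => [|m IH]; rewrite ?gact_one// !expgS gact_mul IH.
Qed.

(* The induced action of K on H^abf, see abf_actE. *)
Definition abf_act (k : K) (x : abf H) : abf H :=
  abf_proj (a k (reprq (reprq x))).

Lemma abf_projP h h' : abf_proj h = abf_proj h' <->
  exists2 m : nat, (0 < m)%N & comm_sub setT setT ((h^-1 * h') ^+ m : H).
Proof.
rewrite /abf_proj clsP//= -clsV// -clsM// /torsion/=.
split=> -[m m0 hm]; exists m => //; move: hm; rewrite -clsX//.
  by move/cls1P; apply.
by move=> hm; apply/cls1P.
Qed.

Lemma abf_projK x : abf_proj (reprq (reprq x)) = x :> abf H.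
Proof. by rewrite /abf_proj !reprqK. Qed.

Lemma abf_actE k h : abf_act k (abf_proj h) = abf_proj (a k h).
Proof.
rewrite /abf_act; set h' := reprq _.
have /abf_projP[m m0 hm] : abf_proj h' = abf_proj h by rewrite abf_projK.
apply/abf_projP; exists m => //; rewrite -gactV -gact_mul -gactX.
have : comm_sub setT setT `<=` [set g : H | comm_sub setT setT (a k g)].
  apply/comm_sub_subP => [|x y _ _ /=]; last by rewrite gact_comm; apply: mem_comm_sub.
  have [D1 DM DV] := subgroup_comm_sub [set: H] setT.
  split=> [|x y /= xD yD|x /= xD]; first by rewrite /= gact_one.
  - by rewrite gact_mul; apply: DM.
  - by rewrite gactV; apply: DV.
exact.
Qed.

Definition trivial_on_abf : Prop := forall k x, abf_act k x = x.

End ActionTheory.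

Definition semidirect (K H : groupType) (a : gact K H) : Type := (H * K)%type.

HB.instance Definition _ (K H : groupType) (a : gact K H) :=
  Choice.on (semidirect a).

Section SemidirectProduct.
Variables (K H : groupType) (a : gact K H).
Implicit Types x y z : semidirect a.

Definition sdmul x y : semidirect a := (x.1 * a x.2 y.1, x.2 * y.2).
Definition sdone : semidirect a := (1, 1).
Definition sdinv x : semidirect a := (a x.2^-1 x.1^-1, x.2^-1).

Lemma sdmulA : associative sdmul.
Proof. by move=> x y z; rewrite /sdmul /= gact_mul gactM !mulgA. Qed.
Lemma sdmul1 : left_id sdone sdmul.
Proof. by case=> h k; rewrite /sdmul /= gact1 !mul1g. Qed.
Lemma sdmulr1 : right_id sdone sdmul.
Proof. by case=> h k; rewrite /sdmul /= gact_one !mulg1. Qed.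
Lemma sdmulV : left_inverse sdone sdinv sdmul.
Proof. by case=> h k; rewrite /sdmul /= -gact_mul !mulVg gact_one. Qed.
Lemma sdmulrV : right_inverse sdone sdinv sdmul.
Proof. by case=> h k; rewrite /sdmul /= -gactM !mulgV gact1 mulgV. Qed.

HB.instance Definition _ :=
  isGroup.Build (semidirect a) sdmulA sdmul1 sdmulr1 sdmulV sdmulrV.

Definition inH (h : H) : semidirect a := (h, 1).
Definition inK (k : K) : semidirect a := (1, k).

(* gamma_i^K(H) is first formed inside the semidirect product, then viewed as
   a subset of H. *)
Fixpoint lcs_act_sd (n : nat) : set (semidirect a) :=
  if n is m.+1 then
    (if m is 0 then range inH else comm_sub setT (lcs_act_sd m))
  else range inH.

Definition lcs_act (i : nat) : set H := inH @^-1` lcs_act_sd i.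

(* C = A >| B inside the semidirect product, for A <= H and B <= K. *)
Definition is_semidirect (C : set (semidirect a)) (A : set H) (B : set K) : Prop :=
  [/\ subgroup A, subgroup B, forall k h, B k -> A h -> A (a k h)
    & C = [set x | A x.1 /\ B x.2]].

Definition compat (FH : nat -> set H) (FK : nat -> set K) : Prop :=
  forall i j, (0 < i)%N -> (0 < j)%N ->
  comm_sub (inK @` FK j) (inH @` FH i) `<=` inH @` FH (i + j)%N.

End SemidirectProduct.
Arguments inH {K H} a h.
Arguments inK {K H} a k.

Local Open Scope ring_scope.

HB.mixin Record isLieRing L of GRing.Zmodule L := {
  bracket : L -> L -> L;
  bracketDl : forall x y z, bracket (x + y) z = bracket x z + bracket y z;
  bracketDr : forall x y z, bracket x (y + z) = bracket x y + bracket x z;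
  bracketxx : forall x, bracket x x = 0;
  jacobi : forall x y z, bracket x (bracket y z) + bracket y (bracket z x)
                         + bracket z (bracket x y) = 0 }.

#[short(type="lieRingType")]
HB.structure Definition LieRing := {L of isLieRing L & GRing.Zmodule L}.

(* A grading L = \bigoplus_i L_i with [L_i, L_j] <= L_(i+j); the set homog i is
   the subgroup L_i of L. *)
HB.mixin Record isGradedLie L of LieRing L := {
  homog : nat -> set L;
  homog0 : forall i, homog i 0;
  homogB : forall i x y, homog i x -> homog i y -> homog i (x - y);
  homog_bracket : forall i j x y,
    homog i x -> homog j y -> homog (i + j)%N (bracket x y);
  homog_sum : forall x, exists n (f : nat -> L),
    (forall i, homog i (f i)) /\ x = \sum_(i < n) f i;
  homog_free : forall n (f : nat -> L), (forall i, homog i (f i)) ->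
    \sum_(i < n) f i = 0 -> forall i, (i < n)%N -> f i = 0 }.

#[short(type="gradedLieType")]
HB.structure Definition GradedLie := {L of isGradedLie L & LieRing L}.

Definition graded_lie_iso (L M : gradedLieType) (f : L -> M) : Prop :=
  [/\ bijective f, forall x y, f (x + y) = f x + f y,
      forall x y, f (bracket x y) = bracket (f x) (f y)
    & forall i x, homog i x <-> homog i (f x)].

(* The additive group G_{n+1} / G_{n+2}. *)
Definition piece (G : groupType) (F : nat -> set G) (cF : central F) (n : nat)
  : Type := quo (csec cF n).

Section Piece.
Variables (G : groupType) (F : nat -> set G) (cF : central F) (n : nat).

HB.instance Definition _ := Choice.on (piece cF n).

Lemma quo_csecC (x y : quo (csec cF n)) : (x * y = y * x)%g.
Proof. by apply: quo_commute => a b _ /= Fb; apply: (central_comm cF). Qed.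

Lemma pieceA : associative (fun x y : piece cF n => (x * y)%g : piece cF n).
Proof. exact: (@mulgA (quo (csec cF n))). Qed.
Lemma pieceC : commutative (fun x y : piece cF n => (x * y)%g : piece cF n).
Proof. exact: quo_csecC. Qed.
Lemma piece0 : left_id (1%g : piece cF n) (fun x y => (x * y)%g).
Proof. exact: (@mul1g (quo (csec cF n))). Qed.
Lemma pieceN : left_inverse (1%g : piece cF n) (fun x => (x^-1)%g : piece cF n)
  (fun x y => (x * y)%g).
Proof. exact: (@mulVg (quo (csec cF n))). Qed.

HB.instance Definition _ :=
  GRing.isZmodule.Build (piece cF n) pieceA pieceC piece0 pieceN.

(* The class of g in G_{n+1} / G_{n+2}, with the junk value 0 when g is not in
   G_{n+1}. *)
Definition pcls (g : G) : piece cF n := cls (csec cF n) g.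
Definition prepr (x : piece cF n) : G := reprq x.

Lemma preprP x : F n.+1 (prepr x).
Proof. exact: (reprq_top (x : quo (csec cF n))). Qed.

Lemma preprK x : pcls (prepr x) = x.
Proof. exact: (reprqK (x : quo (csec cF n))). Qed.

Lemma pclsM g h : F n.+1 g -> F n.+1 h -> pcls (g * h)%g = pcls g + pcls h.
Proof. exact: (@clsM _ (csec cF n)). Qed.

Lemma pclsV g : F n.+1 g -> pcls (g^-1)%g = - pcls g.
Proof. exact: (@clsV _ (csec cF n)). Qed.

Lemma pcls0P g : F n.+1 g -> pcls g = 0 <-> F n.+2 g.
Proof. exact: (@cls1P _ (csec cF n)). Qed.

Lemma pcls_bot g : F n.+2 g -> pcls g = 0.
Proof. by move=> Fg; apply/pcls0P => //; apply: (central_sub cF). Qed.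

Lemma pcls1 : pcls 1%g = 0.
Proof. by []. Qed.

Lemma pcls_conj a g : F n.+1 g -> pcls (a * g * a^-1)%g = pcls g.
Proof.
move=> Fg; have Fc : F n.+2 (comm a g) by apply: (central_comm cF).
rewrite commE_conj pclsM//; last exact: (central_sub cF).
by rewrite pcls_bot// add0r.
Qed.

Lemma prepr_cls g : F n.+1 g -> exists2 b, F n.+2 b & prepr (pcls g) = (g * b)%g.
Proof. exact: (@cls_repr _ (csec cF n)). Qed.

End Piece.

(* The direct sum of the G_{n+1} / G_{n+2}: the component of degree n+1 of x
   is gr_val x n. *)
Record gr (G : groupType) (F : nat -> set G) (nF : nseries F) := Gr {
  gr_val :> forall n, piece (nseries_central nF) n;
  gr_fin : exists N, forall n, (N <= n)%N -> gr_val n = 0 }.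

HB.instance Definition _ (G : groupType) (F : nat -> set G) (nF : nseries F) :=
  gen_eqMixin (gr nF).
HB.instance Definition _ (G : groupType) (F : nat -> set G) (nF : nseries F) :=
  gen_choiceMixin (gr nF).

Section GrZmodule.
Variables (G : groupType) (F : nat -> set G) (nF : nseries F).
Implicit Types x y z : gr nF.
Let cF := nseries_central nF.

Lemma grP x y : (forall n, x n = y n) -> x = y.
Proof.
case: x y => [f pf] [g pg] /= fg.
have {fg} E : f = g by apply: functional_extensionality_dep.
by rewrite E in pf *; rewrite (Prop_irrelevance pf pg).
Qed.

Lemma gr0_fin : exists N, forall n, (N <= n)%N -> 0 = 0 :> piece cF n.
Proof. by exists 0%N. Qed.
Definition gr0 : gr nF := Gr gr0_fin.

Lemma grN_fin x : exists N, forall n, (N <= n)%N -> - x n = 0.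
Proof. by have [N xN] := gr_fin x; exists N => n /xN ->; rewrite oppr0. Qed.
Definition grN x : gr nF := Gr (grN_fin x).

Lemma grD_fin x y : exists N, forall n, (N <= n)%N -> x n + y n = 0.
Proof.
have [[N xN] [M yM]] := (gr_fin x, gr_fin y); exists (maxn N M) => n.
by rewrite geq_max => /andP[/xN -> /yM ->]; rewrite addr0.
Qed.
Definition grD x y : gr nF := Gr (grD_fin x y).

Lemma grDA : associative grD.
Proof. by move=> x y z; apply: grP => n /=; rewrite addrA. Qed.
Lemma grDC : commutative grD.
Proof. by move=> x y; apply: grP => n /=; rewrite addrC. Qed.
Lemma gr0D : left_id gr0 grD.
Proof. by move=> x; apply: grP => n /=; rewrite add0r. Qed.
Lemma grND : left_inverse gr0 grN grD.
Proof. by move=> x; apply: grP => n /=; rewrite addNr. Qed.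

HB.instance Definition _ := GRing.isZmodule.Build (gr nF) grDA grDC gr0D grND.

Lemma gr_sumE n (I : Type) (r : seq I) (P : pred I) (f : I -> gr nF) :
  (\sum_(i <- r | P i) f i) n = \sum_(i <- r | P i) f i n.
Proof. by apply: (big_morph (fun x : gr nF => x n)). Qed.

Lemma dir_fin i g :
  exists N, forall n, (N <= n)%N -> (if n.+1 == i then pcls cF n g else 0) = 0.
Proof.
by exists i => n; case: eqP => // <-; rewrite ltnn.
Qed.

(* The homogeneous element of degree i given by the class of g in
   G_i / G_{i+1}; it is only meaningful for i >= 1 and g in G_i. *)
Definition dir (i : nat) (g : G) : gr nF := Gr (dir_fin i g).

Lemma dirE i g n : dir i g n = if n.+1 == i then pcls cF n g else 0.
Proof. by []. Qed.

Lemma dirSE n g : dir n.+1 g n = pcls cF n g.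
Proof. by rewrite dirE eqxx. Qed.

Lemma dirM i g h : F i.+1 g -> F i.+1 h ->
  dir i.+1 (g * h)%g = dir i.+1 g + dir i.+1 h.
Proof.
move=> Fg Fh; apply: grP => n; rewrite [RHS]/= !dirE.
by case: eqP => [[->]|_]; rewrite ?addr0// pclsM.
Qed.

Lemma dirV i g : F i.+1 g -> dir i.+1 (g^-1)%g = - dir i.+1 g.
Proof.
move=> Fg; apply: grP => n; rewrite [RHS]/= !dirE.
by case: eqP => [[->]|_]; rewrite ?oppr0// pclsV.
Qed.

Lemma dir_conj i a g : F i.+1 g -> dir i.+1 (a * g * a^-1)%g = dir i.+1 g.
Proof.
move=> Fg; apply: grP => n; rewrite !dirE.
by case: eqP => [[->]|_] //; rewrite pcls_conj.
Qed.

Lemma dir1 i : dir i 1%g = 0.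
Proof. by apply: grP => n; rewrite dirE; case: eqP. Qed.

Lemma gr_ind (P : gr nF -> Prop) : P 0 -> (forall x y, P x -> P y -> P (x + y)) ->
  (forall i g, F i.+1 g -> P (dir i.+1 g)) -> forall x, P x.
Proof.
move=> P0 PD Pd x; have [N] := gr_fin x; elim: N x => [|N IH] x xN.
  by rewrite (_ : x = 0)//; apply: grP => n; rewrite xN.
pose d := dir N.+1 (prepr (x N)).
have -> : x = (x - d) + d by rewrite subrK.
apply: PD; last by apply: Pd; apply: preprP.
apply: IH => n; rewrite leq_eqVlt => /predU1P[<-|Nn].
  by rewrite /= eqxx preprK subrr.
by rewrite /= eqSS gtn_eqF// subr0 xN.
Qed.

(* [x, y]_{n+1} is the sum over (i+1) + (j+1) = n+1 of [x_{i+1}, y_{j+1}] *)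
Definition pbr n i j (u : piece cF i) (v : piece cF j) : piece cF n :=
  pcls cF n (comm (prepr u) (prepr v)).

Lemma nser_comm i j a b :
  F i.+1 a -> F j.+1 b -> F (i + j).+2 (comm a b).
Proof.
move=> Fa Fb; rewrite -addSn -addnS; case: nF => _ /(_ i.+1 j.+1 isT isT).
by apply; apply: mem_comm_sub.
Qed.

Lemma pcls_commMl i j a a' b : F i.+1 a -> F i.+1 a' -> F j.+1 b ->
  pcls cF (i + j).+1 (comm (a * a') b) =
  pcls cF (i + j).+1 (comm a b) + pcls cF (i + j).+1 (comm a' b).
Proof.
move=> Fa Fa' Fb; have FF := nser_comm Fa' Fb.
rewrite commMl pclsM ?pcls_conj 1?addrC//; [exact: central_norm|exact: nser_comm].
Qed.

Lemma pcls_commMr i j a b b' : F i.+1 a -> F j.+1 b -> F j.+1 b' ->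
  pcls cF (i + j).+1 (comm a (b * b')) =
  pcls cF (i + j).+1 (comm a b) + pcls cF (i + j).+1 (comm a b').
Proof.
move=> Fa Fb Fb'; have FF := nser_comm Fa Fb'.
rewrite commMr pclsM ?pcls_conj//; [exact: nser_comm|exact: central_norm].
Qed.

Lemma pbr_cls n i j a b : n = (i + j).+1 -> F i.+1 a -> F j.+1 b ->
  pbr n (pcls cF i a) (pcls cF j b) = pcls cF n (comm a b).
Proof.
move=> -> Fa Fb; rewrite /pbr.
have [a' Fa' ->] := prepr_cls cF Fa; have [b' Fb' ->] := prepr_cls cF Fb.
have Fa2 := central_sub cF Fa'; have Fb2 := central_sub cF Fb'.
have Fbb : F j.+1 (b * b')%g by case: (central_grp cF j) => _ + _; apply.
rewrite pcls_commMl// [X in _ + X]pcls_bot ?addr0; last first.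
  by have := nser_comm Fa' Fbb; rewrite addSn.
rewrite pcls_commMr// [X in _ + X]pcls_bot ?addr0//.
by have := nser_comm Fa Fb'; rewrite addnS.
Qed.

Lemma pbrDl n i j u u' v : n = (i + j).+1 ->
  @pbr n i j (u + u') v = pbr n u v + pbr n u' v.
Proof.
move->.
have [Fu Fu' Fv] := And3 (preprP u) (preprP u') (preprP v).
have Fuu : F i.+1 (prepr u * prepr u')%g by case: (central_grp cF i) => _ + _; apply.
rewrite -{1}(preprK u) -{1}(preprK u') -{1}(preprK v) -pclsM// pbr_cls//.
by rewrite pcls_commMl.
Qed.

Lemma pbrDr n i j u v v' : n = (i + j).+1 ->
  @pbr n i j u (v + v') = pbr n u v + pbr n u v'.
Proof.
move->.
have [Fu Fv' Fv] := And3 (preprP u) (preprP v') (preprP v).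
have Fvv : F j.+1 (prepr v * prepr v')%g by case: (central_grp cF j) => _ + _; apply.
rewrite -{1}(preprK u) -{1}(preprK v') -{1}(preprK v) -pclsM// pbr_cls//.
by rewrite pcls_commMr.
Qed.

Lemma pbr0l n i j v : n = (i + j).+1 -> @pbr n i j 0 v = 0.
Proof.
move->.
have := pbrDl (0 : piece cF i) 0 v erefl; rewrite addr0 => /eqP.
by rewrite -subr_eq0 opprD addrA subrr sub0r oppr_eq0 => /eqP.
Qed.

Lemma pbr0r n i j u : n = (i + j).+1 -> @pbr n i j u 0 = 0.
Proof.
move->.
have := pbrDr u (0 : piece cF j) 0 erefl; rewrite addr0 => /eqP.
by rewrite -subr_eq0 opprD addrA subrr sub0r oppr_eq0 => /eqP.
Qed.

Lemma bridx n (i : 'I_n) : n = (i + (n - i.+1)).+1.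
Proof. by rewrite -addSn subnKC. Qed.

Definition brc x y n : piece cF n :=
  \sum_(i < n) pbr n (x i) (y (n - i.+1)%N).

Lemma brc_fin x y : exists N, forall n, (N <= n)%N -> brc x y n = 0.
Proof.
have [[N xN] [M yM]] := (gr_fin x, gr_fin y); exists (N + M)%N => n NM.
apply: big1 => i _; have [Ni|iN] := leqP N i.
  by rewrite xN// pbr0l//; apply: bridx.
rewrite yM ?pbr0r//; first exact: bridx.
by rewrite leq_subRL//; apply: leq_trans NM; rewrite leq_add2r.
Qed.
Definition br x y : gr nF := Gr (brc_fin x y).

Lemma brDl x y z : br (x + y) z = br x z + br y z.
Proof.
apply: grP => n; rewrite [RHS]/= /brc -big_split /=.
by apply: eq_bigr => i _; apply/pbrDl/bridx.
Qed.

Lemma brDr x y z : br x (y + z) = br x y + br x z.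
Proof.
apply: grP => n; rewrite [RHS]/= /brc -big_split /=.
by apply: eq_bigr => i _; apply/pbrDr/bridx.
Qed.

(* The bracket is induced by commutators. *)
Lemma br_dir i j g h : F i.+1 g -> F j.+1 h ->
  br (dir i.+1 g) (dir j.+1 h) = dir (i.+1 + j.+1) (comm g h).
Proof.
move=> Fg Fh; apply: grP => n; rewrite [LHS]/= /brc dirE addSn addnS.
case: eqP => [[->{n}]|nij]; last first.
  apply: big1 => k _; rewrite !dirE !eqSS.
  case: eqP => [E|_]; last by rewrite pbr0l//; apply: bridx.
  case: eqP => [E'|_]; last by rewrite pbr0r//; apply: bridx.
  by case: nij; rewrite -E -E' -bridx.
have ik : (i < (i + j).+1)%N by rewrite ltnS leq_addr.
rewrite (bigD1 (Ordinal ik))//= big1 ?addr0.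
  have -> : ((i + j).+1 - i.+1 = j)%N by rewrite subSS addKn.
  by rewrite !eqxx pbr_cls.
move=> k; rewrite -val_eqE /= eqSS => /negPf ->.
by rewrite pbr0l//; apply: bridx.
Qed.

Lemma br0l x : br 0 x = 0.
Proof. by apply: (addrI (br 0 x)); rewrite -brDl !addr0. Qed.

Lemma br0r x : br x 0 = 0.
Proof. by apply: (addrI (br x 0)); rewrite -brDr !addr0. Qed.

Lemma br_anti x y : br x y = - br y x.
Proof.
elim/gr_ind: x => [|x x' E E'|i g Fg]; first by rewrite br0l br0r oppr0.
  by rewrite brDl brDr E E' opprD.
elim/gr_ind: y => [|y y' E E'|j h Fh]; first by rewrite br0l br0r oppr0.
  by rewrite brDl brDr E E' opprD.
rewrite !br_dir// (addnC j.+1) addSn addnS commV dirV//.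
by rewrite addnC; apply: nser_comm.
Qed.

Lemma brxx x : br x x = 0.
Proof.
elim/gr_ind: x => [|x y E E'|i g Fg]; first by rewrite br0l.
  by rewrite brDl !brDr E E' add0r addr0 br_anti addNr.
by rewrite br_dir// (_ : comm g g = 1%g) ?dir1// /comm !gnorm.
Qed.

Lemma add3ACA (V : zmodType) (a a' b b' c c' : V) :
  (a + a') + (b + b') + (c + c') = (a + b + c) + (a' + b' + c').
Proof. by rewrite (addrACA a a' b) [LHS]addrACA. Qed.

Lemma br_jacobi x y z : br x (br y z) + br y (br z x) + br z (br x y) = 0.
Proof.
elim/gr_ind: x => [|x x' E E'|i a Fa]; first by rewrite !(br0l, br0r) !addr0.
  by rewrite !(brDl, brDr) add3ACA E E' addr0.
elim/gr_ind: y => [|y y' E E'|j b Fb]; first by rewrite !(br0l, br0r) !addr0.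
  by rewrite !(brDl, brDr) add3ACA E E' addr0.
elim/gr_ind: z => [|z z' E E'|k c Fc]; first by rewrite !(br0l, br0r) !addr0.
  by rewrite !(brDl, brDr) add3ACA E E' addr0.
have T l m n g h t : F l.+1 g -> F m.+1 h -> F n.+1 t ->
  br (dir n.+1 t) (br (dir l.+1 g) (dir m.+1 h)) =
  - dir (l + m + n).+3 (comm (comm g h) (h * t * h^-1)%g).
  move=> Fg Fh Ft; rewrite br_anti br_dir// addSn addnS.
  have Fgh := nser_comm Fg Fh.
  rewrite -(dir_conj h Ft) br_dir ?addnS ?addSn//.
  exact: central_norm.
have Fcomm l m n g h t : F l.+1 g -> F m.+1 h -> F n.+1 t ->
  F (l + m + n).+3 (comm (comm g h) (h * t * h^-1)%g).
  move=> Fg Fh Ft; have Fgh := nser_comm Fg Fh.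
  by apply: (@nser_comm (l + m).+1 n) => //; apply: central_norm.
rewrite !T// -!opprD.
have -> : (j + k + i = i + j + k)%N by rewrite addnC addnA.
have -> : (k + i + j = i + j + k)%N by rewrite -addnA addnC.
have F1 := Fcomm _ _ _ _ _ _ Fa Fb Fc.
have := Fcomm _ _ _ _ _ _ Fb Fc Fa.
have -> : (j + k + i = i + j + k)%N by rewrite addnC addnA.
move=> F2; have := Fcomm _ _ _ _ _ _ Fc Fa Fb.
have -> : (k + i + j = i + j + k)%N by rewrite -addnA addnC.
move=> F3.
rewrite addrC addrA -!dirM//; last first.
  by case: (central_grp cF (i + j + k).+2) => _ + _; apply.
by rewrite Hall_Witt dir1 oppr0.
Qed.

End GrZmodule.

Section GrLie.
Variables (G : groupType) (F : nat -> set G) (nF : nseries F).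
Implicit Types x y z : gr nF.

HB.instance Definition _ := isLieRing.Build (gr nF) (@brDl G F nF)
  (@brDr G F nF) (@brxx G F nF) (@br_jacobi G F nF).

Definition gr_homog (i : nat) : set (gr nF) :=
  [set x | forall n, n.+1 != i -> x n = 0].

Lemma gr_homog0 i : gr_homog i 0. Proof. by []. Qed.

Lemma gr_homogB i x y : gr_homog i x -> gr_homog i y -> gr_homog i (x - y).
Proof. by move=> hx hy n ni; rewrite [LHS]/= hx// hy// subrr. Qed.

Lemma gr_homog_bracket i j x y : gr_homog i x -> gr_homog j y ->
  gr_homog (i + j)%N (bracket x y).
Proof.
move=> hx hy n nij; rewrite [LHS]/= /brc big1// => k _.
have [ki|ki] := eqVneq k.+1 i; last by rewrite hx// pbr0l//; apply: bridx.
rewrite [X in pbr _ _ X]hy ?pbr0r//; first exact: bridx.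
by apply: contraNneq nij => <-; rewrite -ki addnS addSn -bridx.
Qed.

Lemma gr_homog_dir i g : gr_homog i (dir nF i g).
Proof. by move=> n /negPf ni; rewrite dirE ni. Qed.

Lemma gr_homog_sum x : exists n (f : nat -> gr nF),
  (forall i, gr_homog i (f i)) /\ x = \sum_(i < n) f i.
Proof.
have [N xN] := gr_fin x; exists N.+1.
exists (fun i => if i is m.+1 then dir nF i (prepr (x m)) else 0); split.
  by move=> [|i] //; apply: gr_homog_dir.
rewrite big_ord_recl add0r; apply: grP => n; rewrite gr_sumE /=.
have [Nn|nN] := leqP N n.
  rewrite xN// big1// => -[i iN] _ /=; rewrite eqSS.
  by rewrite gtn_eqF// (leq_trans iN).
rewrite (bigD1 (Ordinal nN))//= eqxx preprK big1 ?addr0// => i.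
by rewrite -val_eqE /= eqSS eq_sym => /negPf ->.
Qed.

Lemma gr_homog_free n (f : nat -> gr nF) : (forall i, gr_homog i (f i)) ->
  \sum_(i < n) f i = 0 -> forall i, (i < n)%N -> f i = 0.
Proof.
move=> hf f0 i ni; apply: grP => m.
have [mi|mi] := eqVneq m.+1 i; last exact: hf.
have := congr1 (fun x : gr nF => x m) f0; rewrite gr_sumE.
rewrite (bigD1 (Ordinal ni))//= big1 ?addr0// => j.
by rewrite -val_eqE /= -mi eq_sym => ji; apply: hf.
Qed.

HB.instance Definition _ := isGradedLie.Build (gr nF) gr_homog0 gr_homogB
  gr_homog_bracket gr_homog_sum gr_homog_free.

End GrLie.

Local Open Scope group_scope.

Section SemidirectGr.
Variables (K H : groupType) (a : gact K H).
Variables (FH : nat -> set H) (FK : nat -> set K).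
Variables (nH : nseries FH) (nK : nseries FK) (c : compat a FH FK).
Let cH := nseries_central nH.
Let cK := nseries_central nK.

Implicit Types (k : K) (h : H).

Definition semidirect_seq (n : nat) : set (semidirect a) :=
  [set x | FH n x.1 /\ FK n x.2].
Local Notation FL := semidirect_seq.

Lemma sdME h h' k k' :
  ((h, k) : semidirect a) * (h', k') = (h * a k h', k * k') :> semidirect a.
Proof. by []. Qed.

Lemma sdVE h k :
  ((h, k) : semidirect a)^-1 = (a k^-1 h^-1, k^-1) :> semidirect a.
Proof. by []. Qed.

Lemma sdE h k : (h, k) = inH a h * inK a k :> semidirect a.
Proof. by rewrite sdME gact1 mulg1 mul1g. Qed.

Lemma inHM h h' : inH a (h * h') = inH a h * inH a h'.
Proof. by rewrite sdME gact1 mulg1. Qed.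

Lemma inHV h : inH a h^-1 = (inH a h)^-1.
Proof. by rewrite sdVE invg1 gact1. Qed.

Lemma inKM k k' : inK a (k * k') = inK a k * inK a k'.
Proof. by rewrite sdME gact_one mulg1. Qed.

Lemma inKV k : inK a k^-1 = (inK a k)^-1.
Proof. by rewrite sdVE invg1 gact_one. Qed.

Lemma inH_comm h h' : inH a (comm h h') = comm (inH a h) (inH a h').
Proof. by rewrite /comm !inHM !inHV. Qed.

Lemma inK_comm k k' : inK a (comm k k') = comm (inK a k) (inK a k').
Proof. by rewrite /comm !inKM !inKV. Qed.

Lemma conj_KH k h : inK a k * inH a h * (inK a k)^-1 = inH a (a k h).
Proof. by rewrite -inKV !sdME gact_one mul1g !mulg1 mulgV. Qed.

Lemma comm_KH k h : comm (inK a k) (inH a h) = inH a (a k h * h^-1).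
Proof. by rewrite /comm conj_KH -inHV -inHM. Qed.

Lemma compatP i j k h : FK j.+1 k -> FH i.+1 h ->
  FH (i + j).+2 (a k h * h^-1).
Proof.
move=> Fk Fh; have : comm_sub (inK a @` FK j.+1) (inH a @` FH i.+1)
    (inH a (a k h * h^-1)%g).
  by rewrite -comm_KH; apply: mem_comm_sub; [exists k|exists h].
move=> /(c (ltn0Sn i) (ltn0Sn j)) [h' Fh' [<-]].
by rewrite -addSn -addnS.
Qed.

Lemma FH_act n k h : FH n.+1 h -> FH n.+1 (a k h).
Proof.
move=> Fh; have K1 : FK 1%N k by case: nK => -[-> _ _] _.
rewrite -(mulgVK h (a k h)); case: (central_grp cH n) => _ + _; apply=> //.
by apply: (central_sub cH); have := compatP K1 Fh; rewrite addn0.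
Qed.

Lemma FL_grp n : subgroup (FL n.+1).
Proof.
have [H1 HM HV] := central_grp cH n; have [K1 KM KV] := central_grp cK n.
split=> // [[h k] [h' k'] [Hh Kk] [Hh' Kk']|[h k] [Hh Kk]]; split=> /=.
- by apply: HM => //; apply: FH_act.
- exact: KM.
- by apply/FH_act/HV.
- exact: KV.
Qed.

Lemma FL_H n h : FH n.+1 h -> FL n.+1 (inH a h).
Proof. by split=> //=; case: (central_grp cK n). Qed.

Lemma FL_K n k : FK n.+1 k -> FL n.+1 (inK a k).
Proof. by split=> //=; case: (central_grp cH n). Qed.

Lemma FL_normK n x k : FL n.+1 x -> FL n.+1 (inK a k * x * (inK a k)^-1).
Proof.
case: x => h k' [/= Hh Kk]; rewrite -inKV !sdME; split=> /=.
  by rewrite gact_one mulg1 mul1g; apply: FH_act.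
exact: central_norm.
Qed.

Lemma FL_normH n x h : FL n.+1 x -> FL n.+1 (inH a h * x * (inH a h)^-1).
Proof.
have [H1 HM HV] := central_grp cH n.
case: x => h' k [/= Hh Kk]; rewrite -inHV !sdME; split; last first.
  by rewrite /= mul1g mulg1.
rewrite /= gact1 mul1g.
have -> : (h * h' * a k h^-1 =
  (h * h' * h^-1) * (h^-1^-1 * (a k h^-1 * h^-1^-1) * h^-1^-1^-1))%g.
  by rewrite !gnorm.
apply: HM; first exact: central_norm.
apply: (central_norm cH); have H1' : FH 1%N h^-1 by case: nH => -[-> _ _] _.
by apply: (central_sub cH); have := compatP Kk H1'; rewrite add0n.
Qed.

Lemma FL_norm n x y : FL n.+1 x -> FL n.+1 (y * x * y^-1).
Proof.
move=> Lx; case: y => h k; rewrite sdE.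
have -> : (inH a h * inK a k) * x * (inH a h * inK a k)^-1 =
  inH a h * (inK a k * x * (inK a k)^-1) * (inH a h)^-1 by rewrite !gnorm.
exact/FL_normH/FL_normK.
Qed.

Lemma FL_nseries : nseries FL.
Proof.
split; first split.
- apply/seteqP; split=> // x _.
  by case: nH nK => -[E _ _] _ [[E' _ _] _]; rewrite /FL /= E E'.
- by move=> [//|n] _; apply: FL_grp.
- by move=> [//|n] _ x [xH xK]; split; [apply: (central_sub cH)|apply: (central_sub cK)].
move=> [//|i] [//|j] _ _; apply/comm_sub_subP; rewrite addSn addnS.
  exact: FL_grp.
have [_ LM LV] := FL_grp (i + j).+1.
move=> [h k] [h' k'] [/= Hh Kk] [/= Hh' Kk']; rewrite [X in comm X]sdE [X in comm _ X]sdE.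
rewrite commMl; apply: (LM); [apply: FL_norm|]; rewrite commMr; apply: (LM).
- rewrite comm_KH; apply: FL_H.
  by rewrite addnC; apply: compatP.
- by apply: FL_norm; rewrite -inK_comm; apply: FL_K; apply: (nser_comm nK).
- by rewrite -inH_comm; apply: FL_H; apply: (nser_comm nH).
apply: FL_norm; rewrite commV; apply: LV; rewrite comm_KH; apply: FL_H.
exact: compatP.
Qed.

Local Open Scope ring_scope.

(* The action of gr K on gr H induced by (k . h) h^-1: the component of
   degree n+1 of the image is the sum over (i+1) + (j+1) = n+1. *)
Definition acrc (x : gr nK) (y : gr nH) (n : nat) : piece cH n :=
  \sum_(i < n) pcls cH n
    (a (prepr (x i)) (prepr (y (n - i.+1)%N)) * (prepr (y (n - i.+1)%N))^-1)%g.

Let cL := nseries_central FL_nseries.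

Definition iHp n (u : piece cH n) : piece cL n := pcls cL n (inH a (prepr u)).
Definition iKp n (u : piece cK n) : piece cL n := pcls cL n (inK a (prepr u)).

Lemma iHp_cls n h : FH n.+1 h -> iHp (pcls cH n h) = pcls cL n (inH a h).
Proof.
move=> Hh; rewrite /iHp; have [b Hb ->] := prepr_cls cH Hh.
have Hb' := central_sub cH Hb.
rewrite inHM pclsM ?[pcls _ _ (inH a b)]pcls_bot ?addr0//; exact: FL_H.
Qed.

Lemma iKp_cls n k : FK n.+1 k -> iKp (pcls cK n k) = pcls cL n (inK a k).
Proof.
move=> Kk; rewrite /iKp; have [b Kb ->] := prepr_cls cK Kk.
have Kb' := central_sub cK Kb.
rewrite inKM pclsM ?[pcls _ _ (inK a b)]pcls_bot ?addr0//; exact: FL_K.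
Qed.

Lemma iHpD n (u v : piece cH n) : iHp (u + v) = iHp u + iHp v.
Proof.
have [Hu Hv] := (preprP u, preprP v).
rewrite -{1}(preprK u) -{1}(preprK v) -pclsM// iHp_cls.
  by rewrite inHM pclsM//; apply: FL_H.
by case: (central_grp cH n) => _ + _; apply.
Qed.

Lemma iKpD n (u v : piece cK n) : iKp (u + v) = iKp u + iKp v.
Proof.
have [Ku Kv] := (preprP u, preprP v).
rewrite -{1}(preprK u) -{1}(preprK v) -pclsM// iKp_cls.
  by rewrite inKM pclsM//; apply: FL_K.
by case: (central_grp cK n) => _ + _; apply.
Qed.

Lemma iHp0 n : iHp (0 : piece cH n) = 0.
Proof. by apply: (addrI (iHp 0)); rewrite -iHpD !addr0. Qed.

Lemma iKp0 n : iKp (0 : piece cK n) = 0.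
Proof. by apply: (addrI (iKp 0)); rewrite -iKpD !addr0. Qed.

Lemma iHKp_inj n (u : piece cH n) (v : piece cK n) : iHp u + iKp v = 0 ->
  u = 0 /\ v = 0.
Proof.
have [Hu Kv] := (preprP u, preprP v).
rewrite /iHp /iKp -pclsM; [|exact: FL_H|exact: FL_K].
rewrite -sdE => /pcls0P []; first by split.
by move=> /= Hu' Kv'; rewrite -(preprK u) -(preprK v) !pcls_bot.
Qed.

Lemma iHp_sum n (m : nat) (f : 'I_m -> piece cH n) :
  iHp (\sum_(i < m) f i) = \sum_(i < m) iHp (f i).
Proof. by apply: (big_morph (@iHp n) (@iHpD n) (iHp0 n)). Qed.

Lemma iKp_sum n (m : nat) (f : 'I_m -> piece cK n) :
  iKp (\sum_(i < m) f i) = \sum_(i < m) iKp (f i).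
Proof. by apply: (big_morph (@iKp n) (@iKpD n) (iKp0 n)). Qed.

Lemma FKH_act n (i : 'I_n) (u : piece cK i) (v : piece cH (n - i.+1)) :
  FH n.+1 (a (prepr u) (prepr v) * (prepr v)^-1)%g.
Proof.
by rewrite [in FH _](bridx i) addnC; apply: compatP; apply: preprP.
Qed.

Lemma acrc_iHp x y n : iHp (acrc x y n) =
  \sum_(i < n) pbr n (iKp (x i)) (iHp (y (n - i.+1)%N)).
Proof.
rewrite /acrc iHp_sum; apply: eq_bigr => i _.
rewrite iHp_cls; last exact: FKH_act.
rewrite -comm_KH /iKp /iHp pbr_cls//; first exact: bridx.
  by apply: FL_K; apply: preprP.
by apply: FL_H; apply: preprP.
Qed.

Lemma iH_fin (x : gr nH) : exists N, forall n, (N <= n)%N -> iHp (x n) = 0.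
Proof. by have [N xN] := gr_fin x; exists N => n /xN ->; rewrite iHp0. Qed.
Definition iH (x : gr nH) : gr FL_nseries := Gr (iH_fin x).

Lemma iK_fin (x : gr nK) : exists N, forall n, (N <= n)%N -> iKp (x n) = 0.
Proof. by have [N xN] := gr_fin x; exists N => n /xN ->; rewrite iKp0. Qed.
Definition iK (x : gr nK) : gr FL_nseries := Gr (iK_fin x).

Lemma acr_fin x y : exists N, forall n, (N <= n)%N -> acrc x y n = 0.
Proof.
have [N xyN] := gr_fin (br (iK x) (iH y)); exists N => n /xyN E.
have /iHKp_inj[] // : iHp (acrc x y n) + iKp (0 : piece cK n) = 0.
by rewrite iKp0 addr0 acrc_iHp.
Qed.
Definition acr (x : gr nK) (y : gr nH) : gr nH := Gr (acr_fin x y).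

Lemma iHD x y : iH (x + y) = iH x + iH y.
Proof. by apply: grP => n; apply: iHpD. Qed.

Lemma iKD x y : iK (x + y) = iK x + iK y.
Proof. by apply: grP => n; apply: iKpD. Qed.

Lemma iHN x : iH (- x) = - iH x.
Proof.
have iH0 : iH 0 = 0 by apply: grP => n; apply: iHp0.
by apply/eqP; rewrite -subr_eq0 opprK -iHD addNr iH0.
Qed.

Lemma iH_br x y : iH (br x y) = br (iH x) (iH y).
Proof.
apply: grP => n; rewrite [LHS]/= [RHS]/= /brc iHp_sum; apply: eq_bigr => i _.
rewrite /pbr iHp_cls; last first.
  by rewrite [in FH _](bridx i); apply: (nser_comm nH); apply: preprP.
rewrite inH_comm -[RHS]/(pbr _ _ _) /iHp pbr_cls//; first exact: bridx.
  by apply: FL_H; apply: preprP.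
by apply: FL_H; apply: preprP.
Qed.

Lemma iK_br x y : iK (br x y) = br (iK x) (iK y).
Proof.
apply: grP => n; rewrite [LHS]/= [RHS]/= /brc iKp_sum; apply: eq_bigr => i _.
rewrite /pbr iKp_cls; last first.
  by rewrite [in FK _](bridx i); apply: (nser_comm nK); apply: preprP.
rewrite inK_comm -[RHS]/(pbr _ _ _) /iKp pbr_cls//; first exact: bridx.
  by apply: FL_K; apply: preprP.
by apply: FL_K; apply: preprP.
Qed.

Lemma iH_acr x y : iH (acr x y) = br (iK x) (iH y).
Proof. by apply: grP => n; apply: acrc_iHp. Qed.

Lemma iHK_inj x y : iH x + iK y = 0 -> x = 0 /\ y = 0.
Proof.
move=> E; have {}E n : x n = 0 /\ y n = 0.
  by apply: iHKp_inj; apply: (congr1 (fun z : gr FL_nseries => z n) E).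
by split; apply: grP => n; case: (E n).
Qed.

Lemma iH_dir i h : FH i.+1 h -> iH (dir nH i.+1 h) = dir FL_nseries i.+1 (inH a h).
Proof.
move=> Hh; apply: grP => n; rewrite [LHS]/= [RHS]/=.
by case: eqP => [[->]|_]; [apply: iHp_cls|apply: iHp0].
Qed.

Lemma iK_dir i k : FK i.+1 k -> iK (dir nK i.+1 k) = dir FL_nseries i.+1 (inK a k).
Proof.
move=> Kk; apply: grP => n; rewrite [LHS]/= [RHS]/=.
by case: eqP => [[->]|_]; [apply: iKp_cls|apply: iKp0].
Qed.

(* The action on classes. *)
Lemma acr_dir i j k h : FK j.+1 k -> FH i.+1 h ->
  acr (dir nK j.+1 k) (dir nH i.+1 h) = dir nH (i.+1 + j.+1) (a k h * h^-1)%g.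
Proof.
move=> Kk Hh; rewrite addSn addnS.
suff /iHK_inj[/eqP] : iH (acr (dir nK j.+1 k) (dir nH i.+1 h)
    - dir nH (i + j).+2 (a k h * h^-1)%g) + iK 0 = 0 by rewrite subr_eq0 => /eqP.
have -> : iK 0 = 0 by apply: grP => n; apply: iKp0.
rewrite addr0 iHD iHN iH_acr iH_dir ?iK_dir// br_dir; [|exact: FL_K|exact: FL_H].
rewrite comm_KH iH_dir; last exact: compatP.
by rewrite addSn addnS addnC subrr.
Qed.

End SemidirectGr.

Arguments iHp {K H a FH FK} nH nK c n u.
Arguments iKp {K H a FH FK} nH nK c n u.
Arguments iH {K H a FH FK} nH nK c x.
Arguments iK {K H a FH FK} nH nK c x.
Arguments acr {K H a FH FK nH nK} c x y.

Definition sdgr (K H : groupType) (a : gact K H) (FH : nat -> set H)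
    (FK : nat -> set K) (nH : nseries FH) (nK : nseries FK)
    (c : compat a FH FK) : Type :=
  (gr nH * gr nK)%type.

HB.instance Definition _ (K H : groupType) (a : gact K H) (FH : nat -> set H)
    (FK : nat -> set K) (nH : nseries FH) (nK : nseries FK)
    (c : compat a FH FK) :=
  GRing.Zmodule.on (sdgr nH nK c).

Section SemidirectLie.
Variables (K H : groupType) (a : gact K H).
Variables (FH : nat -> set H) (FK : nat -> set K).
Variables (nH : nseries FH) (nK : nseries FK) (c : compat a FH FK).
Implicit Types x y z : sdgr nH nK c.

Definition sdbr x y : sdgr nH nK c :=
  (bracket x.1 y.1 + acr c x.2 y.1 - acr c y.2 x.1, bracket x.2 y.2).

Let J x : gr (FL_nseries nH nK c) := iH nH nK c x.1 + iK nH nK c x.2.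

Lemma sdJ_inj x y : J x = J y -> x = y.
Proof.
move=> /eqP; rewrite -subr_eq0 => /eqP E.
have [] : x.1 - y.1 = 0 /\ x.2 - y.2 = 0.
  apply: (@iHK_inj _ _ _ _ _ nH nK c); rewrite -[RHS]E /J !iHD iHN.
  have -> : iK nH nK c (x.2 - y.2) = iK nH nK c x.2 - iK nH nK c y.2.
    have iK0 : iK nH nK c 0 = 0 by apply: grP => n; apply: iKp0.
    rewrite iKD; congr (_ + _); apply/eqP.
    by rewrite -subr_eq0 opprK -iKD addNr iK0.
  by rewrite opprD addrACA.
move=> /eqP; rewrite subr_eq0 => /eqP E1 /eqP; rewrite subr_eq0 => /eqP E2.
by case: x y E1 E2 {E} => ? ? [? ?] /= -> ->.
Qed.

Lemma sdJD x y : J (x + y) = J x + J y.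
Proof. by rewrite /J iHD iKD addrACA. Qed.

Lemma sdJ0 : J 0 = 0.
Proof. by apply: (addrI (J 0)); rewrite -sdJD !addr0. Qed.

Lemma sdJ_br x y : J (sdbr x y) = br (J x) (J y).
Proof.
rewrite /J /= !iHD iHN iH_br iK_br !iH_acr brDl !brDr.
rewrite (br_anti (iH _ _ _ x.1) (iK _ _ _ y.2)).
by rewrite !addrA; congr (_ + _); rewrite addrAC.
Qed.

Lemma sdbrDl x y z : sdbr (x + y) z = sdbr x z + sdbr y z.
Proof. by apply: sdJ_inj; rewrite sdJ_br !sdJD !sdJ_br brDl. Qed.

Lemma sdbrDr x y z : sdbr x (y + z) = sdbr x y + sdbr x z.
Proof. by apply: sdJ_inj; rewrite sdJ_br !sdJD !sdJ_br brDr. Qed.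

Lemma sdbrxx x : sdbr x x = 0.
Proof. by apply: sdJ_inj; rewrite sdJ_br sdJ0 brxx. Qed.

Lemma sdbr_jacobi x y z :
  sdbr x (sdbr y z) + sdbr y (sdbr z x) + sdbr z (sdbr x y) = 0.
Proof. by apply: sdJ_inj; rewrite !sdJD !sdJ_br sdJ0 br_jacobi. Qed.

HB.instance Definition _ := isLieRing.Build (sdgr nH nK c)
  sdbrDl sdbrDr sdbrxx sdbr_jacobi.

Definition sd_homog (i : nat) : set (sdgr nH nK c) :=
  [set x | homog i x.1 /\ homog i x.2].

Lemma sd_homog0 i : sd_homog i 0. Proof. by split; apply: homog0. Qed.

Lemma sd_homogB i x y : sd_homog i x -> sd_homog i y -> sd_homog i (x - y).
Proof. by move=> [x1 x2] [y1 y2]; split; apply: homogB. Qed.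

Lemma acr_homog i j (u : gr nK) (v : gr nH) : homog i u -> homog j v ->
  homog (i + j)%N (acr c u v).
Proof.
move=> hu hv n nij.
have /iHKp_inj[]// : iHp nH nK c n (acr c u v n) + iKp nH nK c n 0 = 0.
rewrite iKp0 addr0 acrc_iHp big1// => k _.
have [ki|ki] := eqVneq k.+1 i; last by rewrite hu// iKp0 pbr0l//; apply: bridx.
rewrite [X in iHp _ _ _ _ X]hv ?iHp0 ?pbr0r//; first exact: bridx.
by apply: contraNneq nij => <-; rewrite -ki addnS addSn -bridx.
Qed.

Lemma sd_homog_bracket i j x y : sd_homog i x -> sd_homog j y ->
  sd_homog (i + j)%N (bracket x y).
Proof.
move=> [x1 x2] [y1 y2]; split; last exact: homog_bracket.
apply: homogB; last by rewrite addnC; apply: acr_homog.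
rewrite -[acr _ _ _]opprK; apply: homogB; first exact: homog_bracket.
by rewrite -sub0r; apply: homogB; [apply: homog0|apply: acr_homog].
Qed.

Lemma sd_homog_sum x : exists n (f : nat -> sdgr nH nK c),
  (forall i, sd_homog i (f i)) /\ x = \sum_(i < n) f i.
Proof.
have [n [f [hf xf]]] := homog_sum x.1; have [m [g [hg xg]]] := homog_sum x.2.
exists (maxn n m); exists (fun i => (if (i < n)%N then f i else 0,
                                     if (i < m)%N then g i else 0)); split.
  by move=> i; split=> /=; case: ifP => // _; apply: homog0.
have S1 (I : Type) (r : seq I) (h : I -> sdgr nH nK c) :
    (\sum_(i <- r) h i).1 = \sum_(i <- r) (h i).1 by apply: (big_morph fst).
have S2 (I : Type) (r : seq I) (h : I -> sdgr nH nK c) :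
    (\sum_(i <- r) h i).2 = \sum_(i <- r) (h i).2 by apply: (big_morph snd).
rewrite [LHS]surjective_pairing [RHS]surjective_pairing; congr pair.
  rewrite S1 /= xf -big_mkcond/= (big_ord_widen (maxn n m) f)//.
  exact: leq_maxl.
rewrite S2 /= xg -big_mkcond/= (big_ord_widen (maxn n m) g)//.
exact: leq_maxr.
Qed.

Lemma sd_homog_free n (f : nat -> sdgr nH nK c) :
  (forall i, sd_homog i (f i)) ->
  \sum_(i < n) f i = 0 -> forall i, (i < n)%N -> f i = 0.
Proof.
move=> hf f0 i ni; rewrite [LHS]surjective_pairing; congr pair.
  apply: (@homog_free _ n (fun i => (f i).1)) => // [j|]; first by case: (hf j).
  by rewrite -[RHS](congr1 fst f0); apply/esym/(big_morph fst).
apply: (@homog_free _ n (fun i => (f i).2)) => // [j|]; first by case: (hf j).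
by rewrite -[RHS](congr1 snd f0); apply/esym/(big_morph snd).
Qed.

HB.instance Definition _ := isGradedLie.Build (sdgr nH nK c)
  sd_homog0 sd_homogB sd_homog_bracket sd_homog_sum sd_homog_free.

End SemidirectLie.

(* Main.v *)
Require Import Defs.
From HB Require Import structures.
From mathcomp Require Import all_boot all_algebra.
From mathcomp Require Import boolp classical_sets.

(** The whole statement is reduced to one construction, made inside a group G
    for two normal subgroups H <= X. Put R_0 = H and let R_{n+1} consist of the
    elements of R_n having a positive power in [X, R_n]; put C_0 = H and
    C_{n+1} = [X, C_n]. Indices here start at 0, so that R_n stands in degree
    n + 1.

    Since [X, R_n] contains the commutators of R_n, R_{n+1} is the preimage of
    the torsion of the abelian group R_n / [X, R_n]; hence every R_n is a normal
    subgroup of G, [X, R_n] <= R_{n+1} and R_n / R_{n+1} is torsion-free. By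
    construction R is the smallest series from H with the last two properties
    ([rel_ratlcs_min]); for X = H = G it is the rational lower central series
    ([ratlcsE]).

    - R_n = H meet sqrt(C_n) ([rel_ratlcsE]). The point is that [X, R_n] is
      contained in sqrt(C_{n+1}) when R_n is contained in sqrt(C_n). Adjoin
      N = C_{n+1} to the X-central series of R_n: S_0 = R_n and
      S_{k+1} = <[X, S_k], N>. Since [x, y]^m = [x, y^m] modulo S_{k+2} for y in
      S_k, each S_{k+1} is contained in sqrt(S_{k+2}), and S_{n+1} <= N.
    - Writing R_j(X, H) for the series R_j of the pair, [R_j(X, H), R_i(X, X)]
      lies in R_{i+j+1}(X, H) ([rel_ratlcs_comm2]). This is an induction on i
      by the three subgroups lemma; the passage from [X, R_i] to its roots
      R_{i+1} uses torsion-freeness of the target. For X = H it says that R is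
      an N-series.
    - If [G, H] <= R_1(H, H), then [G, R_n(H, H)] <= R_{n+1}(H, H) for all n
      by the same argument, whence R_n(G, H) = R_n(H, H) ([rel_ratlcs_acted]).

    In G = H >| K the isolators A_i of the gamma_i^K(H) are the terms of the
    series R(G, H). By the second point they form an N-series, and so does
    A >| gamma^Q(K); the latter is torsion-free, so it contains gamma^Q(H >| K),
    and the converse inclusion is clear on each factor ([ratlcs_semidirect]).
    Triviality of the action on H^abf means [G, H] <= R_1(H, H), which gives
    the third assertion. Finally, gr(H) >| gr(K) maps to gr(H >| K) by the sum
    of the two inclusions; this map respects brackets, is injective degree by
    degree and hits all homogeneous classes ([semidirect_gr_iso]). *)

Set Implicit Arguments.
Unset Strict Implicit.
Unset Printing Implicit Defensive.

Import GRing.Theory.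

Local Open Scope classical_set_scope.
Local Open Scope group_scope.

(** * Commutators and normal subgroups *)

Definition conj_closed (G : groupType) (A : set G) : Prop :=
  forall x a, A a -> A (x * a * x^-1).

Definition nsubgroup (G : groupType) (A : set G) : Prop :=
  subgroup A /\ conj_closed A.

Section Commutators.
Variable G : groupType.
Implicit Types (A B C N : set G) (x y : G).

Lemma nsubgroupT : nsubgroup [set: G].
Proof. by []. Qed.

Lemma subgroup_smallest A : subgroup (smallest (@subgroup G) A).
Proof. by apply: subgroup_bigcap => B []. Qed.

Lemma subgroup_conj x B : subgroup B -> subgroup [set a | B (x * a * x^-1)].
Proof.
move=> [B1 BM BV]; split=> [|a b /= Ba Bb|a /= Ba] /=.
- by rewrite mulg1 mulgV.
- by have := BM _ _ Ba Bb; rewrite !gnorm.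
- by have := BV _ Ba; rewrite !gnorm.
Qed.

Lemma nsubgroup_smallest A :
  conj_closed A -> nsubgroup (smallest (@subgroup G) A).
Proof.
move=> cA; split=> [|x]; first exact: subgroup_smallest.
apply: smallest_sub; first by apply/subgroup_conj/subgroup_smallest.
by move=> a Aa; apply: sub_gen_smallest; apply: cA.
Qed.

Lemma commJ x a b : x * comm a b * x^-1 =
  comm (x * a * x^-1) (x * b * x^-1) :> G.
Proof. by rewrite /comm !gnorm. Qed.

Lemma conj_closed_comms A B : conj_closed A -> conj_closed B ->
  conj_closed [set comm a b | a in A & b in B].
Proof.
move=> cA cB x _ [a Aa [b Bb <-]]; rewrite commJ.
by exists (x * a * x^-1); [apply: cA|exists (x * b * x^-1) => //; apply: cB].
Qed.

Lemma nsubgroup_comm_sub A B :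
  conj_closed A -> conj_closed B -> nsubgroup (comm_sub A B).
Proof.
by move=> cA cB; apply: nsubgroup_smallest; apply: conj_closed_comms.
Qed.

Lemma comm_subS A A' B B' : A `<=` A' -> B `<=` B' ->
  comm_sub A B `<=` comm_sub A' B'.
Proof.
move=> sA sB; apply/comm_sub_subP; first exact: subgroup_comm_sub.
by move=> a b /sA Aa /sB Bb; apply: mem_comm_sub.
Qed.

Lemma subgroup_commC N a b : subgroup N -> N (comm a b) -> N (comm b a).
Proof. by move=> [_ _ NV] /NV; rewrite -commV. Qed.

Lemma nsubgroup_commr N x a : nsubgroup N -> N a -> N (comm x a).
Proof. by move=> [[_ NM NV] cN] Na; apply: NM; [apply: cN|apply: NV]. Qed.

Lemma subgroupX A a m : subgroup A -> A a -> A (a ^+ m).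
Proof.
move=> [A1 AM _] Aa; elim: m => [|m IH]; first by rewrite expg0.
by rewrite expgS; apply: AM.
Qed.

Lemma conj_expg x a m : (x * a * x^-1) ^+ m = x * a ^+ m * x^-1 :> G.
Proof.
rewrite -[x in x * a]invgK -mulgA -[LHS]/((a ^ x^-1) ^+ m) -conjXg conjgE.
by rewrite invgK mulgA.
Qed.

(** The Hall-Witt identity settles single commutators [a, b]; normality of N
    extends the conclusion to the subgroup that they generate. *)
Lemma three_subgroups A B C N : nsubgroup N ->
  conj_closed A -> conj_closed B -> conj_closed C ->
  (forall a b c, A a -> B b -> C c -> N (comm (comm b c) a)) ->
  (forall a b c, A a -> B b -> C c -> N (comm (comm c a) b)) ->
  forall z c, comm_sub A B z -> C c -> N (comm z c).
Proof.
move=> [[N1 NM NV] cN] cA cB cC BCA CAB z c ABz Cc; move: z ABz.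
apply: smallest_sub => [|_ [a Aa [b Bb <-]] /=].
  split=> [|y z /= Ny Nz|z /= Nz] /=.
  - by rewrite /comm !gnorm.
  - by rewrite commMl; apply: NM => //; apply: cN.
  - have -> : comm z^-1 c = z^-1 * (comm z c)^-1 * z^-1^-1.
      by rewrite /comm !gnorm.
    by apply/cN/NV.
have Cc' : C (b^-1 * c * b^-1^-1) by apply: cC.
(* This conjugate of c makes [a, b], c the entries of the first factor. *)
have := Hall_Witt a b (b^-1 * c * b^-1^-1).
have -> : b * (b^-1 * c * b^-1^-1) * b^-1 = c by rewrite !gnorm.
rewrite -mulgA => /eqP; rewrite mulg_eq1 => /eqP ->.
by apply/NV/NM; [apply: BCA => //; apply: cA|apply: CAB => //; apply: cB].
Qed.

(** The rule [x, g h] = [x, g] . g [x, h] g^-1 makes [x, g ^+ m] the m-th power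
    of [x, g] as soon as conjugation by g is trivial on the quotient. *)
Lemma cls_commX (s : section G) x g m : top s (comm x g) ->
  (forall p, top s p -> bot s (comm g p)) ->
  top s (comm x (g ^+ m)) /\ cls s (comm x (g ^+ m)) = cls s (comm x g) ^+ m.
Proof.
move=> sxg gs; elim: m => [|m [IHs IH]].
  rewrite !expg0 (_ : comm x 1 = 1); last by rewrite /comm !gnorm.
  by split=> //; apply: one_in.
have bs := gs _ IHs.
have ts : top s (comm g (comm x (g ^+ m)) * comm x (g ^+ m)).
  by apply: topM => //; apply: bot_top.
rewrite expgS commMr commE_conj expgS; split; first exact: topM.
rewrite clsM// clsM//; last exact: bot_top.
by rewrite (proj2 (cls1P (bot_top bs)) bs) mul1g IH.
Qed.

(** In the abelian quotient these are the elements of finite order. *)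
Lemma isolator_subgroup (s : section G) :
  (forall a b, top s a -> top s b -> bot s (comm a b)) ->
  subgroup [set g | top s g /\ isolator (bot s) g].
Proof.
move=> sab; have sC := quo_commute sab.
have E g : top s g -> isolator (bot s) g <-> torsion (cls s g).
  move=> sg; split=> -[m m0 gm]; exists m => //; move: gm; rewrite -clsX//.
    by move=> gm; apply/cls1P => //; apply: topX.
  by move/cls1P; apply; apply: topX.
split=> [|g h [sg ig] [sh ih]|g [sg [m m0 gm]]]; split=> //.
- exact: one_in.
- by exists 1%N => //; rewrite expg1; apply: bot1.
- exact: topM.
- move: ig ih; rewrite !E//; last exact: topM.
  move=> [m m0 gm] [n n0 hn]; exists (m * n)%N; first by rewrite muln_gt0 m0.
  rewrite clsM// expgMn; last exact: sC.
  by rewrite expgnA gm mulnC expgnA hn !expg1n mulg1.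
- exact: topV.
- by exists m => //; rewrite expVgn; apply: botV.
Qed.

End Commutators.
Arguments nsubgroupT {G}.

(** * The relative rational lower central series *)

Definition rel_lcs (G : groupType) (X H : set G) (n : nat) : set G :=
  iter n (comm_sub X) H.

(** Taking the roots one step at a time keeps every term a subgroup for an easy
    reason: the quotient by [X, R_n] is abelian. That the roots of a term of the
    lower central series form a subgroup is then a consequence. *)
Fixpoint rel_ratlcs (G : groupType) (X H : set G) (n : nat) : set G :=
  if n is m.+1 then
    rel_ratlcs X H m `&` isolator (comm_sub X (rel_ratlcs X H m))
  else H.

Section RelativeSeries.
Variables (G : groupType) (X H : set G).
Hypotheses (nX : nsubgroup X) (nH : nsubgroup H) (HX : H `<=` X).

Local Notation R := (rel_ratlcs X H).
Local Notation C := (rel_lcs X H).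

Lemma rel_ratlcs_subS n : R n.+1 `<=` R n.
Proof. by move=> g []. Qed.

Lemma rel_ratlcs_sub n : R n `<=` H.
Proof. by elim: n => // n IH g /rel_ratlcs_subS/IH. Qed.

Lemma rel_ratlcs_nsub n : nsubgroup (R n).
Proof.
elim: n => // n [sR cR].
have [sD cD] := @nsubgroup_comm_sub _ _ _ nX.2 cR.
have DR : comm_sub X (R n) `<=` R n.
  apply/comm_sub_subP => // x r _ Rr; exact: nsubgroup_commr.
split; last first.
  move=> x g [Rg [m m0 gm]]; split; first exact: cR.
  by exists m => //; rewrite conj_expg; apply: cD.
pose s := Section sR sD DR (fun a b _ => cD a b).
apply: (@isolator_subgroup _ s) => a b Ra Rb; apply: mem_comm_sub => //.
exact/HX/(@rel_ratlcs_sub n).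
Qed.

Lemma rel_ratlcs_comm n x g : X x -> R n g -> R n.+1 (comm x g).
Proof.
move=> Xx Rg; split; first exact: nsubgroup_commr (rel_ratlcs_nsub n) Rg.
by exists 1%N; rewrite // expg1; apply: mem_comm_sub.
Qed.

Definition rel_ratlcs_section n : section G :=
  Section (rel_ratlcs_nsub n).1 (rel_ratlcs_nsub n.+1).1 (@rel_ratlcs_subS n)
    (fun a b _ => (rel_ratlcs_nsub n.+1).2 a b).

Lemma rel_ratlcs_isolatedS n g m :
  (0 < m)%N -> R n g -> R n.+1 (g ^+ m) -> R n.+1 g.
Proof.
move=> m0 Rg [_ [k k0 gk]]; split=> //; exists (m * k)%N.
  by rewrite muln_gt0 m0.
by rewrite expgnA.
Qed.

Lemma rel_ratlcs_isolated n g m :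
  (0 < m)%N -> H g -> R n (g ^+ m) -> R n g.
Proof.
move=> m0 Hg; elim: n => // n IH Rgm.
by apply: (rel_ratlcs_isolatedS m0 _ Rgm); apply: IH; case: Rgm.
Qed.

(** How a root g of an element of [X, R_i] is reached in inductions on
    commutators: [y, g]^m = [y, g^m] modulo the next term, whose quotient has no
    torsion. *)
Lemma rel_ratlcs_comm_isolated n y g m : (0 < m)%N -> X g ->
  R n (comm y g) -> R n.+1 (comm y (g ^+ m)) -> R n.+1 (comm y g).
Proof.
move=> m0 Xg Ryg Rygm; apply: (@rel_ratlcs_isolatedS _ _ m) => //.
have [] := @cls_commX _ (rel_ratlcs_section n) y g m Ryg.
  by move=> p; apply: rel_ratlcs_comm.
move=> Rm E; apply/(@cls1P _ (rel_ratlcs_section n)).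
  exact: (@topX _ (rel_ratlcs_section n)).
by rewrite clsX// -E; apply/cls1P.
Qed.

Lemma rel_ratlcs_min (F : nat -> set G) :
  H `<=` F 0%N -> (forall n, subgroup (F n)) ->
  (forall n x g, X x -> F n g -> F n.+1 (comm x g)) ->
  (forall n g m, (0 < m)%N -> F n g -> F n.+1 (g ^+ m) -> F n.+1 g) ->
  forall n, R n `<=` F n.
Proof.
move=> F0 sF cF iF; elim=> // n IH g [/IH Fg [m m0 gm]].
apply: iF m0 Fg _; suff : comm_sub X (R n) `<=` F n.+1 by exact.
by apply/comm_sub_subP => // x r Xx /IH; apply: cF.
Qed.

Lemma rel_lcs_nsub n : nsubgroup (C n).
Proof.
by elim: n => //= n IH; apply: nsubgroup_comm_sub; [apply: nX.2|apply: IH.2].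
Qed.

Lemma rel_lcs_subS n : C n.+1 `<=` C n.
Proof.
have sC := rel_lcs_nsub n.
by apply/comm_sub_subP => [|x g _]; [apply: sC.1|apply: nsubgroup_commr].
Qed.

Lemma rel_lcs_sub m n : (m <= n)%N -> C n `<=` C m.
Proof.
elim: n => [|n IH]; rewrite leq_eqVlt => /predU1P[->//|] //.
by move=> mn g /rel_lcs_subS; apply: IH.
Qed.

Lemma rel_lcs_sub_ratlcs n : C n `<=` R n.
Proof.
elim: n => // n IH; apply/comm_sub_subP; first exact: (rel_ratlcs_nsub n.+1).1.
by move=> x g Xx /IH; apply: rel_ratlcs_comm.
Qed.

(** * Its terms are isolators *)

Section Descent.
Variable N : set G.
Hypotheses (nN : nsubgroup N) (NX : N `<=` X).

(** Iterating this operation from S gives the X-central series of S relative to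
    N. Keeping N inside every term avoids quotienting by N. *)
Definition comm_join (S : set G) : set G :=
  smallest (@subgroup G) ([set comm x g | x in X & g in S] `|` N).

Lemma comm_join_nsub S : conj_closed S -> nsubgroup (comm_join S).
Proof.
move=> cS; apply: nsubgroup_smallest => x a [xa|Na]; [left|right].
  by apply: conj_closed_comms xa => //; apply: nX.2.
exact: nN.2.
Qed.

Lemma mem_comm_join S x g : X x -> S g -> comm_join S (comm x g).
Proof.
by move=> Xx Sg; apply: sub_gen_smallest; left; exists x => //; exists g.
Qed.

Lemma sub_comm_join S : N `<=` comm_join S.
Proof. by move=> g Ng; apply: sub_gen_smallest; right. Qed.

Lemma comm_join_subP S A : subgroup A -> N `<=` A ->
  (forall x g, X x -> S g -> A (comm x g)) -> comm_join S `<=` A.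
Proof.
move=> sA NA SA; apply: smallest_sub => // g [[x Xx [y Sy <-]]|/NA//].
exact: SA.
Qed.

(** Commutation with x is a homomorphism from S to the abelian group
    comm_join S / comm_join (comm_join S). It kills g ^+ m by hypothesis, so the
    generators [x, g] have finite order there. *)
Lemma comm_join_power S : nsubgroup S -> S `<=` X ->
  (forall g, S g -> exists2 m, (0 < m)%N &
     forall x, X x -> comm_join (comm_join S) (comm x (g ^+ m))) ->
  comm_join S `<=` isolator (comm_join (comm_join S)).
Proof.
move=> nS SX Sm; have nS1 := comm_join_nsub nS.2.
have nS2 := comm_join_nsub nS1.2.
have S1X : comm_join S `<=` X.
  apply: comm_join_subP => //; first exact: nX.1.
  by move=> x g _ /SX Xg; apply: nsubgroup_commr.
have S21 : comm_join (comm_join S) `<=` comm_join S.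
  apply: comm_join_subP; [exact: nS1.1|exact: sub_comm_join|].
  by move=> x g _; apply: nsubgroup_commr.
pose s := Section nS1.1 nS2.1 S21 (fun a b _ => nS2.2 a b).
suff : comm_join S `<=` [set g | top s g /\ isolator (bot s) g].
  by move=> sub g /sub[].
apply: comm_join_subP.
- by apply: isolator_subgroup => a b /S1X Xa /= S1b; apply: mem_comm_join.
- move=> g Ng; split; first exact: sub_comm_join.
  by exists 1%N; rewrite // expg1; apply: sub_comm_join.
move=> x g Xx Sg; have S1c := mem_comm_join Xx Sg; split=> //.
have [m m0 gm] := Sm g Sg; exists m => //.
have [|tm E] := @cls_commX _ s x g m S1c.
  by move=> p /= S1p; apply: mem_comm_join => //; apply: SX.
apply/(@cls1P _ s); first exact: (@topX _ s).
by rewrite clsX// -E; apply/cls1P => //; apply: gm.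
Qed.

End Descent.

(** Induction on n: roots modulo C_n are moved to roots modulo C_{n+1} along the
    X-central series of R_n relative to C_{n+1}, which reaches C_{n+1}. *)
Lemma rel_ratlcs_sub_isolator n : R n `<=` isolator (C n).
Proof.
elim: n => [g Hg|n IH]; first by exists 1%N; rewrite // expg1.
pose N := C n.+1.
have nN : nsubgroup N := rel_lcs_nsub n.+1.
have NX : N `<=` X by move=> g /(@rel_lcs_sub 0%N n.+1 isT)/HX.
pose S k := iter k (comm_join N) (R n).
have nS k : nsubgroup (S k).
  elim: k => [|k IHk]; first exact: rel_ratlcs_nsub.
  exact: comm_join_nsub IHk.2.
(* The bound on k matters: N is C_{n+1}, so it lies in C_k only up to there. *)
have SC k : (k <= n.+1)%N -> S k `<=` C k.
  elim: k => [_|k IHk kn]; first exact: rel_ratlcs_sub.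
  apply: comm_join_subP; [exact: (rel_lcs_nsub k.+1).1|exact: rel_lcs_sub|].
  by move=> x g Xx /(IHk (ltnW kn)) Cg; apply: mem_comm_sub.
have SX k : S k `<=` X.
  elim: k => [g /rel_ratlcs_sub/HX//|k IHk]; apply: comm_join_subP => //.
    exact: nX.1.
  by move=> x g _ /IHk Xg; apply: nsubgroup_commr.
have Spow k : S k.+1 `<=` isolator (S k.+2).
  elim: k => [|k IHk].
    apply: (comm_join_power nN NX (nS 0%N) (SX 0%N)) => g Sg.
    have [m m0 gm] := IH g Sg; exists m => // x Xx.
    by apply: sub_comm_join; apply: mem_comm_sub.
  apply: (comm_join_power nN NX (nS k.+1) (SX k.+1)) => g Sg.
  have [m m0 gm] := IHk g Sg; exists m => // x Xx; exact: mem_comm_join.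
have Sn k : S 1%N `<=` isolator (S k.+1).
  elim: k => [|k IHk] g Sg; first by exists 1%N; rewrite // expg1.
  have [m m0 /Spow[l l0 gml]] := IHk g Sg.
  by exists (m * l)%N; rewrite ?muln_gt0 ?m0// expgnA.
move=> g [_ [m m0 gm]].
have /Sn-/(_ n) [l l0 gml] : S 1%N (g ^+ m).
  suff : comm_sub X (R n) `<=` S 1%N by exact.
  apply/comm_sub_subP; first exact: (nS 1%N).1.
  by move=> x r Xx Rr; apply: mem_comm_join.
exists (m * l)%N; first by rewrite muln_gt0 m0.
by rewrite expgnA; apply: SC gml.
Qed.

Lemma rel_ratlcsE n : R n = H `&` isolator (C n).
Proof.
apply/seteqP; split=> g.
  move=> Rg; split; first exact: rel_ratlcs_sub Rg.
  exact: rel_ratlcs_sub_isolator.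
move=> [Hg [m m0 gm]]; apply: rel_ratlcs_isolated m0 Hg _.
exact: rel_lcs_sub_ratlcs.
Qed.

End RelativeSeries.

(** * Commutators of two series *)

Section StrongCentrality.
Variables (G : groupType) (X H : set G).
Hypotheses (nX : nsubgroup X) (nH : nsubgroup H) (HX : H `<=` X).

(** With H = X this is the N-series property. The general form also controls
    the commutators of the terms of a subgroup K of X with those of H. *)
Lemma rel_ratlcs_comm2 i j h x :
  rel_ratlcs X H j h -> rel_ratlcs X X i x ->
  rel_ratlcs X H (i + j).+1 (comm h x).
Proof.
have nR := rel_ratlcs_nsub nX nH HX.
have nRX := rel_ratlcs_nsub nX nX (@subset_refl _ X).
elim: i j h x => [|i IH] j h x Rh Rx.
  by apply: subgroup_commC; [exact: (nR _).1|exact: rel_ratlcs_comm].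
have [Rx' [m m0 xm]] := Rx.
apply: (rel_ratlcs_comm_isolated nX nH HX m0).
- exact: (rel_ratlcs_sub Rx).
- exact: IH.
apply: subgroup_commC; first exact: (nR _).1.
apply: (three_subgroups (A := X) (B := rel_ratlcs X X i)
  (C := rel_ratlcs X H j) (nR _)) xm Rh => //.
- exact: nX.2.
- exact: (nRX i).2.
- exact: (nR j).2.
- move=> a b c Xa Rb Rc; apply: subgroup_commC; first exact: (nR _).1.
  apply: rel_ratlcs_comm => //; apply: subgroup_commC; first exact: (nR _).1.
  exact: IH.
move=> a b c Xa Rb Rc; rewrite addSnnS; apply: IH => //.
by apply: subgroup_commC; [exact: (nR _).1|exact: rel_ratlcs_comm].
Qed.

End StrongCentrality.

Lemma rel_ratlcsS (G : groupType) (X X' H H' : set G) n :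
  X `<=` X' -> H `<=` H' -> rel_ratlcs X H n `<=` rel_ratlcs X' H' n.
Proof.
move=> XX' HH'; elim: n => // n IH g [/IH Rg [m m0 gm]]; split=> //.
by exists m => //; apply: comm_subS gm.
Qed.

(** The hypothesis is the degree-one case of [G, R_n] <= R_{n+1} for the series
    of H acting on itself; commutators and roots propagate it, and minimality of
    the series of G acting on H gives the nontrivial inclusion. *)
Lemma rel_ratlcs_acted (G : groupType) (H : set G) (n : nat) : nsubgroup H ->
  (forall x h, H h -> rel_ratlcs H H 1 (comm x h)) ->
  rel_ratlcs setT H n = rel_ratlcs H H n.
Proof.
move=> nH H1; pose R := rel_ratlcs H H.
have HH : H `<=` H by [].
have nR k : nsubgroup (R k) by exact: (rel_ratlcs_nsub nH nH HH).
have GR k y g : R k g -> R k.+1 (comm y g).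
  elim: k y g => [|k IH] y g Rg; first exact: H1.
  have [Rg' [m m0 gm]] := Rg.
  apply: (rel_ratlcs_comm_isolated nH nH HH m0); first exact: rel_ratlcs_sub Rg.
    exact: nsubgroup_commr.
  apply: subgroup_commC; first exact: (nR k.+2).1.
  apply: (three_subgroups (A := H) (B := R k) (C := setT) (nR k.+2)
    _ _ _ _ _ gm I) => //.
  - exact: nH.2.
  - exact: (nR k).2.
  - move=> a b c Ha Rb _; apply: subgroup_commC; first exact: (nR k.+2).1.
    apply: rel_ratlcs_comm => //.
    apply: subgroup_commC; first exact: (nR k.+1).1.
    exact: IH.
  move=> a b c Ha Rb _; rewrite -addn1; apply: rel_ratlcs_comm2 => //.
  exact: H1.
apply/seteqP; split; last exact: rel_ratlcsS.
move: n; apply: rel_ratlcs_min => //.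
- by move=> k; exact: (nR k).1.
- by move=> k x g _; apply: GR.
exact: rel_ratlcs_isolatedS.
Qed.

(** * Transport along an injective morphism *)

Section Image.
Variables (G G' : groupType) (f : G -> G').
Hypothesis fM : {morph f : x y / x * y}.

Lemma morph1 : f 1 = 1.
Proof. by apply: (@mulgI _ (f 1)); rewrite -fM !mulg1. Qed.

Lemma morphV x : f x^-1 = (f x)^-1.
Proof. by apply: (@mulgI _ (f x)); rewrite -fM !mulgV morph1. Qed.

Lemma morphX x m : f (x ^+ m) = f x ^+ m.
Proof. by elim: m => [|m IH]; rewrite ?morph1// !expgS fM IH. Qed.

Lemma morph_comm x y : f (comm x y) = comm (f x) (f y).
Proof. by rewrite /comm !fM !morphV. Qed.

Lemma subgroup_preimage (A : set G') : subgroup A -> subgroup (f @^-1` A).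
Proof.
move=> [A1 AM AV]; split=> [|x y|x] /=; rewrite ?morph1 ?fM ?morphV//.
- exact: AM.
- exact: AV.
Qed.

Lemma subgroup_image (A : set G) : subgroup A -> subgroup (f @` A).
Proof.
move=> [A1 AM AV]; split=> [|_ _ [x Ax <-] [y Ay <-]|_ [x Ax <-]].
- by exists 1 => //; exact: morph1.
- by exists (x * y); [apply: AM|rewrite fM].
- by exists x^-1; [apply: AV|rewrite morphV].
Qed.

Lemma image_comm_sub (A B : set G) :
  f @` comm_sub A B = comm_sub (f @` A) (f @` B).
Proof.
apply/seteqP; split.
  apply/image_subP; apply/comm_sub_subP.
    exact/subgroup_preimage/subgroup_comm_sub.
  by move=> a b Aa Bb /=; rewrite morph_comm; apply: mem_comm_sub; apply: imageP.
apply/comm_sub_subP; first exact/subgroup_image/subgroup_comm_sub.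
move=> _ _ [a Aa <-] [b Bb <-]; rewrite -morph_comm.
by apply: imageP; apply: mem_comm_sub.
Qed.

Hypothesis finj : injective f.

Lemma image_rel_ratlcs (X H : set G) n :
  f @` rel_ratlcs X H n = rel_ratlcs (f @` X) (f @` H) n.
Proof.
elim: n => // n IH /=; rewrite -IH -image_comm_sub; apply/seteqP; split.
  move=> _ [g [Rg [m m0 gm]] <-]; split; first exact: imageP.
  by exists m; rewrite // -morphX; apply: imageP.
move=> _ [[g Rg <-] [m m0 [d Dd]]]; rewrite -morphX => /finj E.
by exists g => //; split=> //; exists m; rewrite // -E.
Qed.

End Image.

(** * The rational lower central series of a group *)

Section RationalLCS.
Variable G : groupType.

Local Notation R := (rel_ratlcs [set: G] setT).

Lemma lcsE n : lcs G n.+1 = rel_lcs setT setT n.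
Proof. by elim: n => // n IH; rewrite [LHS]/= -/(lcs G n.+1) IH. Qed.

Let R_nsub n : nsubgroup (R n).
Proof. exact: (rel_ratlcs_nsub nsubgroupT nsubgroupT (@subset_refl _ setT)). Qed.

(** In degree 0 the intersection defining ratlcs is empty: the value there of a
    filtration is arbitrary. *)
Definition ratlcs_series (i : nat) : set G := if i is n.+1 then R n else set0.

Lemma ratlcs_series_tf_central : tf_central ratlcs_series.
Proof.
have cF : central ratlcs_series.
  split; first split=> //.
  - by move=> [//|n] _; exact: (R_nsub n).1.
  - by move=> [//|n] _; exact: rel_ratlcs_subS.
  move=> [//|n] _; apply/comm_sub_subP; first exact: (R_nsub n.+1).1.
  by move=> x g Xx; apply: rel_ratlcs_comm.
exists cF => n; apply/torsion_freeE => g m m0 /= Rg.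
exact: (rel_ratlcs_isolatedS m0 Rg).
Qed.

Lemma ratlcsE i : ratlcs G i = ratlcs_series i.
Proof.
apply/seteqP; split; first exact: ratlcs_min ratlcs_series_tf_central.
case: i => [//|n] g Rg F [cF tfF] /=.
apply: (@rel_ratlcs_min _ setT setT (fun n => F n.+1)) Rg => //.
- by have [[-> _ _] _] := cF.
- by move=> k; apply: (central_grp cF).
- by move=> k x h _; apply: (central_comm cF).
by move=> k h m m0; have /torsion_freeE := tfF k; apply.
Qed.

Lemma ratlcs_isolator i : (0 < i)%N -> ratlcs G i = isolator (lcs G i).
Proof.
by case: i => // n _; rewrite ratlcsE lcsE [LHS]/= rel_ratlcsE ?setTI.
Qed.

Lemma ratlcs_nseries : nseries (ratlcs G).
Proof.
have [[fF _] _] := ratlcs_tf_central G; split=> //.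
move=> [//|i] [//|j] _ _; rewrite addSn addnS !ratlcsE.
apply/comm_sub_subP => [|x y Rx Ry]; first exact: (R_nsub (i + j).+1).1.
by rewrite addnC; apply: (rel_ratlcs_comm2 (X := setT) (H := setT)).
Qed.

End RationalLCS.

(** * The semidirect product *)

Section Semidirect.
Variables (K H : groupType) (a : gact K H).
Local Notation L := (semidirect a).
Local Notation HL := (range (inH a)).
Local Notation RH := (rel_ratlcs [set: L] HL).
Local Notation A := (fun i => isolator (lcs_act a i)).

Lemma inH_inj : injective (inH a).
Proof. by move=> h h' []. Qed.

Lemma nsubgroup_inH : nsubgroup HL.
Proof.
split; first by apply: subgroup_image => // h h'; apply: inHM.
move=> [h k] _ [h' _ <-].
exists (h * a k h' * h^-1) => //.
by rewrite !inHM -conj_KH inHV sdE !gnorm.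
Qed.

Let HLT : HL `<=` setT. Proof. by []. Qed.

Let RH_nsub n : nsubgroup (RH n).
Proof. exact: (rel_ratlcs_nsub nsubgroupT nsubgroup_inH HLT). Qed.

Lemma lcs_act_sdE n : @lcs_act_sd K H a n.+1 = rel_lcs setT HL n.
Proof. by elim: n => // n IH; rewrite [LHS]/= -/(@lcs_act_sd K H a n.+1) IH. Qed.

Lemma isolator_lcs_actE n h :
  isolator (lcs_act a n.+1) h <-> RH n (inH a h).
Proof.
rewrite (rel_ratlcsE nsubgroupT nsubgroup_inH HLT) /isolator /lcs_act /=.
split=> [[m m0 hm]|[_ [m m0 hm]]].
  split; first by exists h.
  exists m => //; rewrite -morphX; last exact: inHM.
  by rewrite -lcs_act_sdE.
exists m => //; rewrite -/(@lcs_act_sd K H a n.+1) lcs_act_sdE morphX//.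
exact: inHM.
Qed.

(** The embedding of K sends the series of K to that of its image, which only
    grows when all of the semidirect product is allowed in the commutators. *)
Lemma ratlcs_inK n k : ratlcs K n.+1 k ->
  rel_ratlcs [set: L] setT n (inK a k).
Proof.
rewrite ratlcsE /= => Rk.
have := @imageP _ _ (inK a) _ _ Rk.
rewrite (image_rel_ratlcs (@inKM K H a)); last by move=> ? ? [].
exact: rel_ratlcsS.
Qed.

Lemma rel_ratlcs_inH_sub n : RH n `<=` rel_ratlcs [set: L] setT n.
Proof. exact: rel_ratlcsS. Qed.

Let A_grp n : subgroup (A n.+1).
Proof.
have [[R1 RM RV] _] := RH_nsub n.
split=> [|x y /isolator_lcs_actE Rx /isolator_lcs_actE Ry|
  x /isolator_lcs_actE Rx].
- exact/isolator_lcs_actE.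
- by apply/isolator_lcs_actE; rewrite inHM; apply: RM.
- by apply/isolator_lcs_actE; rewrite inHV; apply: RV.
Qed.

Lemma lcs_act_isolator_nseries : nseries A.
Proof.
split; first split=> //.
- apply/seteqP; split=> // h _; apply/isolator_lcs_actE; exact: imageP.
- by move=> [//|n] _; exact: A_grp.
- by move=> [//|n] _ h /isolator_lcs_actE/rel_ratlcs_subS/isolator_lcs_actE.
move=> [//|i] [//|j] _ _; rewrite addSn addnS.
apply/comm_sub_subP; first exact: A_grp.
move=> x y /isolator_lcs_actE Rx /isolator_lcs_actE Ry.
apply/isolator_lcs_actE; rewrite inH_comm addnC.
apply: (rel_ratlcs_comm2 nsubgroupT nsubgroup_inH HLT) => //.
exact: rel_ratlcs_inH_sub.
Qed.

Lemma lcs_act_isolator_compat : compat a A (ratlcs K).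
Proof.
move=> [//|i] [//|j] _ _; rewrite addSn addnS; apply/comm_sub_subP.
  by apply: subgroup_image; [exact: inHM|exact: A_grp].
move=> _ _ [k Kk <-] [h /isolator_lcs_actE Rh <-]; rewrite comm_KH.
apply: imageP; apply/isolator_lcs_actE; rewrite -comm_KH.
apply: subgroup_commC; first exact: (RH_nsub (i + j).+1).1.
rewrite addnC; apply: (rel_ratlcs_comm2 nsubgroupT nsubgroup_inH HLT) => //.
exact: ratlcs_inK.
Qed.

Local Notation nA := lcs_act_isolator_nseries.
Local Notation nK := (ratlcs_nseries K).
Local Notation S := (@semidirect_seq K H a A (ratlcs K)).
Let nS : nseries S := FL_nseries nA nK lcs_act_isolator_compat.

(** The H-component of (h, k)^m is h (k . h) ... (k^(m-1) . h), and K acts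
    trivially on A_n / A_{n+1}. *)
Lemma cls_semidirect_expg n (x : L) m : S n.+1 x ->
  A n.+1 (x ^+ m).1 /\
  cls (csec (nseries_central nA) n) (x ^+ m).1 =
    cls (csec (nseries_central nA) n) x.1 ^+ m.
Proof.
move=> Sx; have [Ax Kx] := Sx; set s := csec _ n.
have Am l : A n.+1 (x ^+ l).1.
  by case: (subgroupX l (FL_grp nA nK lcs_act_isolator_compat n) Sx).
split=> //; elim: m => [|m IH]; first by rewrite !expg0.
have K1 : ratlcs K 1 x.2 by rewrite ratlcsE.
have := compatP lcs_act_isolator_compat K1 (Am m); rewrite addn0 => b.
have {b} E : cls s (a x.2 (x ^+ m).1) = cls s (x ^+ m).1.
  have tb := @bot_top _ s _ b.
  rewrite -[a x.2 _](mulgVK (x ^+ m).1) (@clsM _ s _ _ tb (Am m)).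
  by rewrite (proj2 (cls1P tb) b) mul1g.
rewrite !expgS -IH -E -(@clsM _ s)//.
by apply: (FH_act nA nK lcs_act_isolator_compat); apply: Am.
Qed.

Lemma semidirect_seq_tf_central : tf_central S.
Proof.
exists (nseries_central nS) => n; apply/torsion_freeE => x m m0 Sx [/= Axm Kxm].
split.
  have [Am E] := cls_semidirect_expg m Sx; have [Ax _] := Sx.
  apply/isolator_lcs_actE.
  apply: (rel_ratlcs_isolatedS (m := m)) => //.
    exact/isolator_lcs_actE.
  rewrite -morphX; last exact: inHM.
  apply/isolator_lcs_actE.
  apply/(@cls1P _ (csec (nseries_central nA) n)).
    by apply: subgroupX => //; apply: A_grp.
  rewrite (@clsX _ (csec (nseries_central nA) n))// -E.
  by apply/cls1P.
have [cK /(_ n) /torsion_freeE tf] := ratlcs_tf_central K.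
apply: (tf _ m m0 Sx.2); move: Kxm; suff -> : (x ^+ m).2 = x.2 ^+ m by [].
by elim: m {m0 Axm} => // m IH; rewrite !expgS /= IH.
Qed.

(** One inclusion is minimality of the rational lower central series; for the
    other, each factor separately lies in it. *)
Lemma ratlcs_semidirect i : (0 < i)%N -> ratlcs L i = S i.
Proof.
case: i => // n _; apply/seteqP; split.
  exact: ratlcs_min semidirect_seq_tf_central.
move=> [h k] [/= /isolator_lcs_actE Ah Kk]; rewrite sdE ratlcsE.
have [[_ RM _] _] :=
  rel_ratlcs_nsub nsubgroupT nsubgroupT (@subset_refl L setT) n.
by apply: RM; [exact: rel_ratlcs_inH_sub|exact: ratlcs_inK].
Qed.

Lemma is_semidirect_ratlcs i : (0 < i)%N ->
  is_semidirect (ratlcs L i) (isolator (lcs_act a i)) (ratlcs K i).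
Proof.
case: i => // n _; split.
- exact: A_grp.
- by have [[_ + _] _] := nK; apply.
- by move=> k h _; apply: (FH_act nA nK lcs_act_isolator_compat).
- exact: ratlcs_semidirect.
Qed.

(** Both sides are relative series inside the semidirect product, of H acted on
    by the whole group and by H alone. Triviality on H^abf gives the hypothesis
    of [rel_ratlcs_acted]. *)
Lemma isolator_lcs_act_abf i : trivial_on_abf a -> (0 < i)%N ->
  isolator (lcs_act a i) = ratlcs H i.
Proof.
move=> triv; case: i => // n _; apply/seteqP.
suff E : RH n = inH a @` rel_ratlcs setT setT n.
  rewrite ratlcsE; split=> h; last first.
    by move=> Rh; apply/isolator_lcs_actE; rewrite E; apply: imageP.
  by move/isolator_lcs_actE; rewrite E => -[h' Rh' /inH_inj <-].
rewrite image_rel_ratlcs; [|exact: inHM|exact: inH_inj].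
apply: rel_ratlcs_acted; first exact: nsubgroup_inH.
move=> [u k] _ [h _ <-].
have nR := rel_ratlcs_nsub nsubgroup_inH nsubgroup_inH (@subset_refl _ HL) 1.
have [[_ RM _] cR] := nR.
rewrite sdE commMl; apply: RM; last first.
  apply: (rel_ratlcs_comm nsubgroup_inH nsubgroup_inH (@subset_refl _ HL));
    exact: imageP.
apply: (cR); rewrite comm_KH.
have /abf_projP[m m0 hm] : abf_proj h = abf_proj (a k h).
  by rewrite -abf_actE triv.
have -> : a k h * h^-1 = h * (h^-1 * a k h) * h^-1 by rewrite !gnorm.
rewrite !inHM inHV; apply: (cR); rewrite -inHV -inHM.
split; first exact: imageP.
exists m => //; rewrite -morphX; last exact: inHM.
rewrite -[X in comm_sub X]/(inH a @` setT) -image_comm_sub; last exact: inHM.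
exact: imageP.
Qed.

End Semidirect.

Local Open Scope ring_scope.

(** * The graded Lie ring of the semidirect product *)

Section GradedIso.
Variables (K H : groupType) (a : gact K H).
Variables (FH : nat -> set H) (FK : nat -> set K).
Variables (nH : nseries FH) (nK : nseries FK) (c : compat a FH FK).

Local Notation nL := (FL_nseries nH nK c).

Definition sd_gr (x : sdgr nH nK c) : gr nL := iH nH nK c x.1 + iK nH nK c x.2.

Lemma sd_gr_dir i h k : (0 < i)%N -> FH i h -> FK i k ->
  sd_gr (dir nH i h, dir nK i k) = dir nL i (h, k).
Proof.
case: i => // i _ Hh Kk; rewrite /sd_gr iH_dir// iK_dir// -dirM ?sdE//.
- exact: FL_H.
- exact: FL_K.
Qed.

Lemma sd_gr_surj y : exists x, sd_gr x = y.
Proof.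
elim/gr_ind: y => [|_ _ [x <-] [y <-]|i [h k] [Hh Kk]].
- by exists 0; apply: sdJ0.
- by exists (x + y); apply: sdJD.
- by exists (dir nH i.+1 h, dir nK i.+1 k); apply: sd_gr_dir.
Qed.

Lemma homog_sd_gr i x : homog i (sd_gr x) <-> homog i x.
Proof.
split=> [hx|[h1 h2] n ni].
  by split=> n ni; have [] := iHKp_inj (hx n ni).
by rewrite [LHS]/= h1// h2// iHp0 iKp0 addr0.
Qed.

(** Stated for a sequence F equal to the semidirect one, because rewriting along
    that equality under the type gr nF is only possible for a variable F. *)
Lemma semidirect_gr_iso (F : nat -> set (semidirect a)) (nF : nseries F) :
  F = semidirect_seq FH FK ->
  exists f : gr nF -> sdgr nH nK c, graded_lie_iso f /\
    forall i h k, (0 < i)%N -> FH i h -> FK i k ->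
      f (dir nF i (h, k)) = (dir nH i h, dir nK i k).
Proof.
move=> FE; subst F; rewrite (Prop_irrelevance nF nL) {nF}.
have [f fK] := choice sd_gr_surj; exists f.
have Kf : cancel sd_gr f by move=> x; apply: (@sdJ_inj _ _ a); apply: fK.
split; last by move=> i h k i0 Hh Kk; rewrite -sd_gr_dir// Kf.
split.
- by exists sd_gr.
- move=> x y; apply: (can_inj Kf); rewrite fK -{1}(fK x) -{1}(fK y).
  by apply/esym/sdJD.
- move=> x y; rewrite -{1}(fK x) -{1}(fK y).
  by rewrite -[bracket (sd_gr _) _]sdJ_br Kf.
- by move=> i x; rewrite -homog_sd_gr fK.
Qed.

End GradedIso.

Theorem theorem3p19 (G : groupType) :
  ((forall i, (0 < i)%N -> ratlcs G i = isolator (lcs G i))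
   /\ nseries (ratlcs G))
  /\ forall (K H : groupType) (a : gact K H),
     (forall i, (0 < i)%N ->
        is_semidirect (ratlcs (semidirect a) i)
          (isolator (lcs_act a i)) (ratlcs K i))
  /\ (trivial_on_abf a -> forall i, (0 < i)%N ->
        isolator (lcs_act a i) = ratlcs H i)
  /\ (trivial_on_abf a ->
      exists (nS : nseries (ratlcs (semidirect a)))
             (nH : nseries (ratlcs H)) (nK : nseries (ratlcs K))
             (c : compat a (ratlcs H) (ratlcs K))
             (f : gr nS -> sdgr nH nK c),
        graded_lie_iso f
        /\ forall i h k, (0 < i)%N -> ratlcs H i h -> ratlcs K i k ->
           f (dir nS i (h, k)) = (dir nH i h, dir nK i k)).
Proof.
split; first by split; [exact: ratlcs_isolator|exact: ratlcs_nseries].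
move=> K H a; split; first exact: is_semidirect_ratlcs.
split=> [triv i|triv]; first exact: isolator_lcs_act_abf.
have E i : (0 < i)%N -> isolator (lcs_act a i) = ratlcs H i.
  exact: isolator_lcs_act_abf.
have c : compat a (ratlcs H) (ratlcs K).
  move=> i j i0 j0; rewrite -!E ?addn_gt0 ?i0//.
  exact: lcs_act_isolator_compat.
exists (ratlcs_nseries _), (ratlcs_nseries _), (ratlcs_nseries _), c.
(* The equality is one of functions, so it includes degree 0. *)
apply: semidirect_gr_iso; apply: funext => -[|i].
  rewrite ratlcsE /semidirect_seq; apply/seteqP; split=> // x [].
  by rewrite ratlcsE.
by rewrite ratlcs_semidirect// /semidirect_seq E.
Qed.
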